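(* Let $f: A\to B$ be an almost quasi-finite homomorphism between noetherian rings of characteristic $p$. Then the following are equivalent: (1) $f$ is regular (i.e. flat with geometrically regular fibers). (2) $f$ is $F$-pure. (3) $f$ is Dumitrescu.
   Context: $p$ is a prime number; rings of characteristic $p$ are $\mathbb{F}_p$-algebras. A homomorphism $f:A\to B$ of noetherian rings is almost quasi-finite if for every $P\in\operatorname{Spec} A$, $\kappa(P)\otimes_A B$ is module-finite over the residue field $\kappa(P)$. An $R$-linear map $M\to M'$ is $R$-pure if $W\otimes_R M\to W\otimes_R M'$ is injective for every $R$-module $W$; a ring homomorphism $R\to R'$ is pure if it is $R$-pure. For a homomorphism $f:A\to B$ of $\mathbb{F}_p$-algebras and $e\ge 0$, let $A^{(e)}$, $B^{(e)}$ be copies of the rings $A$, $B$, with $B^{(e)}$ an $A^{(e)}$-algebra via $f$ and $A$ an $A^{(e)}$-algebra via $a^{(e)}\mapsto a^{p^e}$. The $e$th Radu--André homomorphism is $\Phi_e(A,B): B^{(e)}\otimes_{A^{(e)}}A\to B$, $b^{(e)}\otimes a\mapsto b^{p^e}f(a)$. It is a ring homomorphism, and is $A$-linear when $A$ acts on the source through the second tensor factor and on $B$ via $f$. The map $f$ is $F$-pure if $\Phi_e(A,B)$ is a pure ring homomorphism for every $e\ge 1$; $f$ is Dumitrescu if $\Phi_e(A,B)$ is pure as an $A$-linear map for every $e\ge 1$. *)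

(* Defs.v *)
From HB Require Import structures.
From mathcomp Require Import all_boot all_order all_algebra all_field.
From mathcomp Require Import boolp classical_sets.
From mathcomp Require Import ring.

Set Implicit Arguments.
Unset Strict Implicit.
Unset Printing Implicit Defensive.

Import GRing.Theory.
Local Open Scope ring_scope.
Local Open Scope quotient_scope.
Local Open Scope classical_set_scope.

(* Rings are [comPzRingType]s, i.e. commutative and possibly zero: a fiber
   ring kappa(P) (x)_A B may well be the zero ring. *)

Section Tensor.
Variables (R : comPzRingType) (M N : lmodType R).

(* A word [:: (x1, y1); ...; (xn, yn)] stands for \sum_i xi (x) yi. No formal
   opposites are needed, - (x (x) y) being (- x) (x) y; in exchange the zero
   tensor has to be identified with the empty word. *)
Inductive tens_rel : seq (M * N) -> seq (M * N) -> Prop :=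
| TensRefl s : tens_rel s s
| TensSym s t of tens_rel s t : tens_rel t s
| TensTrans s t u of tens_rel s t & tens_rel t u : tens_rel s u
| TensCat s s' t t' of tens_rel s s' & tens_rel t t' :
    tens_rel (s ++ t) (s' ++ t')
| TensComm s t : tens_rel (s ++ t) (t ++ s)
| TensZero : tens_rel [:: (0, 0)] [::]
| TensAddl x x' y : tens_rel [:: (x + x', y)] [:: (x, y); (x', y)]
| TensAddr x y y' : tens_rel [:: (x, y + y')] [:: (x, y); (x, y')]
| TensBal a x y : tens_rel [:: (a *: x, y)] [:: (x, a *: y)].

Definition tens_eqb (s t : seq (M * N)) : bool := `[< tens_rel s t >].

Fact tens_eqb_refl : reflexive tens_eqb.
Proof. by move=> s; apply/asboolP; exact: TensRefl. Qed.

Fact tens_eqb_sym : symmetric tens_eqb.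
Proof. by move=> s t; apply/asboolP/asboolP; exact: TensSym. Qed.

Fact tens_eqb_trans : transitive tens_eqb.
Proof.
by move=> t s u /asboolP st /asboolP tu; apply/asboolP; exact: TensTrans st tu.
Qed.

Canonical tens_equiv :=
  EquivRel tens_eqb tens_eqb_refl tens_eqb_sym tens_eqb_trans.

Definition tensor : Type := {eq_quot tens_eqb}.
HB.instance Definition _ := Choice.on tensor.
HB.instance Definition _ : EqQuotient _ tens_eqb tensor :=
  EqQuotient.on tensor.

Definition tens_cls (s : seq (M * N)) : tensor := \pi_tensor s.

Definition tens (x : M) (y : N) : tensor := tens_cls [:: (x, y)].

Lemma tens_clsP s t : tens_cls s = tens_cls t <-> tens_rel s t.
Proof.
rewrite /tens_cls; split=> [/eqmodP/asboolP // | st].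
by apply/eqmodP/asboolP.
Qed.

Lemma tens_repr z : tens_cls (repr z) = z.
Proof. by rewrite /tens_cls reprK. Qed.

Lemma tens_rel_repr s : tens_rel (repr (tens_cls s)) s.
Proof. by apply/tens_clsP; rewrite tens_repr. Qed.

Definition tens_add (z w : tensor) := tens_cls (repr z ++ repr w).

Definition tens_scale (a : R) (z : tensor) : tensor :=
  tens_cls [seq (a *: u.1, u.2) | u <- repr z].

Definition tens_opp := tens_scale (- 1).

Lemma tens_add_cls s t :
  tens_add (tens_cls s) (tens_cls t) = tens_cls (s ++ t).
Proof. by apply/tens_clsP; apply: TensCat; exact: tens_rel_repr. Qed.

Lemma tens_rel_scale a s t : tens_rel s t ->
  tens_rel [seq (a *: u.1, u.2) | u <- s] [seq (a *: u.1, u.2) | u <- t].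
Proof.
elim=> {s t} /=.
- by move=> s; exact: TensRefl.
- by move=> s t _; exact: TensSym.
- by move=> s t u _ st _; exact: TensTrans.
- by move=> s s' t t' _ ss' _ tt'; rewrite !map_cat; exact: TensCat.
- by move=> s t; rewrite !map_cat; exact: TensComm.
- by rewrite scaler0; exact: TensZero.
- by move=> x x' y; rewrite scalerDr; exact: TensAddl.
- by move=> x y y'; exact: TensAddr.
- by move=> b x y; rewrite scalerA mulrC -scalerA; exact: TensBal.
Qed.

Lemma tens_scale_cls a s :
  tens_scale a (tens_cls s) = tens_cls [seq (a *: u.1, u.2) | u <- s].
Proof. exact/tens_clsP/tens_rel_scale/tens_rel_repr. Qed.

Lemma tens_cls_ind (K : tensor -> Prop) : (forall s, K (tens_cls s)) -> forall z, K z.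
Proof. by move=> Ks z; rewrite -(tens_repr z). Qed.

Lemma tens0l y : tens_rel [:: (0, y)] [::].
Proof.
apply: TensTrans TensZero; rewrite -[X in (X, y)](scale0r (0 : M)).
by apply: TensTrans (TensBal _ _ _) _; rewrite scale0r; exact: TensRefl.
Qed.

Fact tens_addA : associative tens_add.
Proof.
elim/tens_cls_ind=> s; elim/tens_cls_ind=> t; elim/tens_cls_ind=> u.
by rewrite !tens_add_cls catA.
Qed.

Fact tens_addC : commutative tens_add.
Proof.
elim/tens_cls_ind=> s; elim/tens_cls_ind=> t; rewrite !tens_add_cls.
by apply/tens_clsP; exact: TensComm.
Qed.

Fact tens_add0 : left_id (tens_cls [::]) tens_add.
Proof. by elim/tens_cls_ind=> s; rewrite tens_add_cls. Qed.

Lemma tens_scaleDl z a b :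
  tens_scale (a + b) z = tens_add (tens_scale a z) (tens_scale b z).
Proof.
elim/tens_cls_ind: z => s; rewrite !tens_scale_cls tens_add_cls.
apply/tens_clsP; elim: s => [|[x y] s IHs] /=; first exact: TensRefl.
move: IHs; set sab := map _ s; set sa := map _ s; set sb := map _ s => IHs.
apply: (@TensTrans _ ([:: (a *: x, y); (b *: x, y)] ++ (sa ++ sb))).
  rewrite -[_ :: sab]cat1s; apply: TensCat IHs.
  by rewrite scalerDl; exact: TensAddl.
apply: (@TensCat [:: (a *: x, y)] [:: (a *: x, y)]
                 ([:: (b *: x, y)] ++ (sa ++ sb))
                 (sa ++ ([:: (b *: x, y)] ++ sb))); first exact: TensRefl.
by rewrite !catA; apply: TensCat; [exact: TensComm | exact: TensRefl].
Qed.

Fact tens_addN : left_inverse (tens_cls [::]) tens_opp tens_add.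
Proof.
move=> z; have {2}-> : z = tens_scale 1 z.
  elim/tens_cls_ind: z => s; rewrite tens_scale_cls; congr tens_cls.
  by rewrite -[LHS]map_id; apply: eq_map => -[x y] /=; rewrite scale1r.
rewrite -tens_scaleDl addNr; elim/tens_cls_ind: z => s; rewrite tens_scale_cls.
apply/tens_clsP; elim: s => [|[x y] s IHs] /=; first exact: TensRefl.
rewrite -cat1s -[X in tens_rel _ X]cat0s; apply: TensCat IHs.
by rewrite scale0r; exact: tens0l.
Qed.

HB.instance Definition _ :=
  GRing.isZmodule.Build tensor tens_addA tens_addC tens_add0 tens_addN.

Lemma tens_cls0 : tens_cls [::] = 0. Proof. by []. Qed.

Lemma tens_clsD s t : tens_cls (s ++ t) = tens_cls s + tens_cls t.
Proof. by rewrite [RHS]tens_add_cls. Qed.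

Lemma tens_cls_sum s : tens_cls s = \sum_(u <- s) tens u.1 u.2.
Proof.
elim: s => [|[x y] s IHs]; first by rewrite big_nil.
by rewrite big_cons -cat1s tens_clsD IHs.
Qed.

Fact tens_scaleA a b z : tens_scale a (tens_scale b z) = tens_scale (a * b) z.
Proof.
elim/tens_cls_ind: z => s; rewrite !tens_scale_cls -map_comp; congr tens_cls.
by apply: eq_map => -[x y] /=; rewrite scalerA.
Qed.

Fact tens_scale1 : left_id 1 tens_scale.
Proof.
elim/tens_cls_ind=> s; rewrite tens_scale_cls; congr tens_cls.
by rewrite -[RHS]map_id; apply: eq_map => -[x y] /=; rewrite scale1r.
Qed.

Fact tens_scaleDr : right_distributive tens_scale +%R.
Proof.
move=> a; elim/tens_cls_ind=> s; elim/tens_cls_ind=> t.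
by rewrite -tens_clsD !tens_scale_cls map_cat tens_clsD.
Qed.

HB.instance Definition _ := GRing.Zmodule_isLmodule.Build R tensor
  tens_scaleA tens_scale1 tens_scaleDr (fun z a b => tens_scaleDl z a b).

Lemma tensDl x x' y : tens (x + x') y = tens x y + tens x' y.
Proof. by rewrite -tens_clsD; apply/tens_clsP; exact: TensAddl. Qed.

Lemma tensDr x y y' : tens x (y + y') = tens x y + tens x y'.
Proof. by rewrite -tens_clsD; apply/tens_clsP; exact: TensAddr. Qed.

Lemma tensZl a x y : tens (a *: x) y = a *: tens x y.
Proof. by rewrite [RHS]tens_scale_cls. Qed.

Lemma tensZr a x y : tens x (a *: y) = a *: tens x y.
Proof. by rewrite -tensZl; apply/esym/tens_clsP; exact: TensBal. Qed.

Lemma tensor_ind (K : tensor -> Prop) :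
  K 0 -> (forall x y, K (tens x y)) -> (forall z w, K z -> K w -> K (z + w)) ->
  forall z, K z.
Proof.
move=> K0 Kt KD; elim/tens_cls_ind=> s; rewrite tens_cls_sum.
by elim/big_ind: _ => // u _; exact: Kt.
Qed.

Section Lift.
Variable V : zmodType.

Definition balanced (phi : M -> N -> V) : Prop :=
  [/\ forall x x' y, phi (x + x') y = phi x y + phi x' y,
      forall x y y', phi x (y + y') = phi x y + phi x y' &
      forall a x y, phi (a *: x) y = phi x (a *: y)].

(* Only meaningful for a balanced [phi]: then [tens_lift phi] is the additive
   map sending [tens x y] to [phi x y]. *)
Definition tens_lift (phi : M -> N -> V) (z : tensor) : V :=
  \sum_(u <- repr z) phi u.1 u.2.

Variables (phi : M -> N -> V) (bal : balanced phi).

Lemma tens_rel_sum s t : tens_rel s t ->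
  \sum_(u <- s) phi u.1 u.2 = \sum_(u <- t) phi u.1 u.2.
Proof.
have [phiDl phiDr phiZ] := bal.
elim=> {s t} //=.
- by move=> s t u _ -> _ ->.
- by move=> s s' t t' _ ss' _ tt'; rewrite !big_cat /= ss' tt'.
- by move=> s t; rewrite !big_cat /= addrC.
- rewrite big_seq1 big_nil /=; apply: (@addIr _ (phi 0 0)).
  by rewrite -phiDl !add0r.
- by move=> x x' y; rewrite !big_cons !big_nil /= !addr0.
- by move=> x y y'; rewrite !big_cons !big_nil /= !addr0.
- by move=> a x y; rewrite !big_seq1 /= phiZ.
Qed.

Lemma tens_lift_cls s :
  tens_lift phi (tens_cls s) = \sum_(u <- s) phi u.1 u.2.
Proof. exact/tens_rel_sum/tens_rel_repr. Qed.

Lemma tens_lift_tens x y : tens_lift phi (tens x y) = phi x y.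
Proof. by rewrite tens_lift_cls big_seq1. Qed.

Lemma tens_lift0 : tens_lift phi 0 = 0.
Proof. by rewrite -tens_cls0 tens_lift_cls big_nil. Qed.

Lemma tens_liftD z w :
  tens_lift phi (z + w) = tens_lift phi z + tens_lift phi w.
Proof.
elim/tens_cls_ind: z => s; elim/tens_cls_ind: w => t.
by rewrite -tens_clsD !tens_lift_cls big_cat.
Qed.

End Lift.

End Tensor.

Section Purity.
Variable R : comPzRingType.

Definition tens_map (W M M' : lmodType R) (h : {linear M -> M'}) :
    tensor W M -> tensor W M' :=
  tens_lift (fun w x => tens w (h x)).

Lemma tens_map_balanced (W M M' : lmodType R) (h : {linear M -> M'}) :
  balanced (fun (w : W) (x : M) => tens w (h x)).
Proof.
split=> [w w' x|w x x'|a w x]; first exact: tensDl.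
  by rewrite linearD tensDr.
by rewrite linearZ tensZl tensZr.
Qed.

Lemma tens_mapE (W M M' : lmodType R) (h : {linear M -> M'}) (w : W) x :
  tens_map h (tens w x) = tens w (h x).
Proof. exact/tens_lift_tens/tens_map_balanced. Qed.

Definition pure_linear (M M' : lmodType R) (h : {linear M -> M'}) : Prop :=
  forall W : lmodType R, injective (@tens_map W M M' h).

Definition flat_module (W : lmodType R) : Prop :=
  forall (M M' : lmodType R) (h : {linear M -> M'}),
    injective h -> injective (@tens_map W M M' h).

Definition finitely_generated (M : lmodType R) : Prop :=
  exists n (g : 'I_n -> M),
    forall x, exists c : 'I_n -> R, x = \sum_i c i *: g i.

End Purity.

(* S as an R-module (or R-algebra) through f : R -> S. *)
Definition alg_of (R S : comPzRingType) (f : {rmorphism R -> S}) : Type := S.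

Section AlgOf.
Variables (R S : comPzRingType) (f : {rmorphism R -> S}).
Local Notation alg_of := (alg_of f).

HB.instance Definition _ := GRing.ComPzRing.copy alg_of S.

Definition alg_scale (a : R) (x : alg_of) : alg_of := (f a : alg_of) * x.

Fact alg_scaleA a b x : alg_scale a (alg_scale b x) = alg_scale (a * b) x.
Proof. by rewrite /alg_scale mulrA rmorphM. Qed.

Fact alg_scale1 : left_id 1 alg_scale.
Proof. by move=> x; rewrite /alg_scale rmorph1 mul1r. Qed.

Fact alg_scaleDr : right_distributive alg_scale +%R.
Proof. by move=> a x y; rewrite /alg_scale mulrDr. Qed.

Fact alg_scaleDl x : {morph alg_scale^~ x : a b / a + b}.
Proof. by move=> a b; rewrite /alg_scale rmorphD mulrDl. Qed.

HB.instance Definition _ := GRing.Zmodule_isLmodule.Build R alg_of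
  alg_scaleA alg_scale1 alg_scaleDr alg_scaleDl.

Lemma alg_ofZ (a : R) (x : alg_of) : a *: x = (f a : alg_of) * x.
Proof. by []. Qed.

End AlgOf.

Definition alg_linear (R S S' : comPzRingType) (f : {rmorphism R -> S})
    (f' : {rmorphism R -> S'}) (h : {rmorphism S -> S'}) (hf : h \o f =1 f') :
  alg_of f -> alg_of f' := h.

Section AlgLinear.
Variables (R S S' : comPzRingType).
Variables (f : {rmorphism R -> S}) (f' : {rmorphism R -> S'}).
Variables (h : {rmorphism S -> S'}) (hf : h \o f =1 f').

Fact alg_linear_is_linear : linear (alg_linear hf).
Proof.
by move=> a x y; rewrite /alg_linear /= !alg_ofZ rmorphD rmorphM -hf.
Qed.

HB.instance Definition _ := GRing.isLinear.Build R (alg_of f) (alg_of f') _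
  (alg_linear hf) alg_linear_is_linear.

End AlgLinear.

(* h : R -> S as an R-linear map; [alg_of idfun] is R as a module over itself. *)
Definition pure_rmorphism (R S : comPzRingType) (h : {rmorphism R -> S}) :=
  pure_linear (@alg_linear R R S idfun h h (frefl h)).

Definition flat_rmorphism (R S : comPzRingType) (h : {rmorphism R -> S}) :=
  flat_module (alg_of h).

Definition module_finite (R S : comPzRingType) (h : {rmorphism R -> S}) :=
  finitely_generated (alg_of h).

Section TensorRing.
Variables (R S T : comPzRingType).
Variables (f : {rmorphism R -> S}) (g : {rmorphism R -> T}).

Definition tensor_ring : Type := tensor (alg_of f) (alg_of g).
HB.instance Definition _ := GRing.Lmodule.on tensor_ring.

Definition tens_r (x : S) (y : T) : tensor_ring :=
  tens (x : alg_of f) (y : alg_of g).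

Definition tens_mul1 (x : S) (y : T) : tensor_ring -> tensor_ring :=
  tens_lift (fun (x' : alg_of f) (y' : alg_of g) =>
    tens_r ((x : S) * x') ((y : T) * y')).

Definition tens_mul (z w : tensor_ring) : tensor_ring :=
  tens_lift (fun (x : alg_of f) (y : alg_of g) => tens_mul1 x y w) z.

Lemma tens_rDl x x' y : tens_r (x + x') y = tens_r x y + tens_r x' y.
Proof. exact: tensDl. Qed.

Lemma tens_rDr x y y' : tens_r x (y + y') = tens_r x y + tens_r x y'.
Proof. exact: tensDr. Qed.

Lemma tens_r_bal a x y : tens_r (f a * x) y = tens_r x (g a * y).
Proof. by apply/tens_clsP; exact: TensBal. Qed.

Lemma tens_mul1_balanced x y : balanced
  (fun (x' : alg_of f) (y' : alg_of g) =>
    tens_r ((x : S) * x') ((y : T) * y')).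
Proof.
split=> [x1 x2 y'|x' y1 y2|a x' y'].
- by rewrite mulrDr tens_rDl.
- by rewrite mulrDr tens_rDr.
- by rewrite !alg_ofZ mulrCA tens_r_bal mulrCA.
Qed.

Lemma tens_mul1E x y x' y' :
  tens_mul1 x y (tens_r x' y') = tens_r (x * x') (y * y').
Proof. by rewrite [LHS]tens_lift_tens //; exact: tens_mul1_balanced. Qed.

Lemma tens_mul1D x y z w :
  tens_mul1 x y (z + w) = tens_mul1 x y z + tens_mul1 x y w.
Proof. exact/tens_liftD/tens_mul1_balanced. Qed.

Lemma tens_mul10 x y : tens_mul1 x y 0 = 0.
Proof. exact/tens_lift0/tens_mul1_balanced. Qed.

Lemma tens_mul_balanced w :
  balanced (fun (x : alg_of f) (y : alg_of g) => tens_mul1 x y w).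
Proof.
split=> [x1 x2 y|x y1 y2|a x y]; elim/tensor_ind: w.
- by rewrite !tens_mul10 addr0.
- by move=> x' y'; rewrite -[tens _ _]/(tens_r x' y') !tens_mul1E mulrDl tens_rDl.
- by move=> z w zE wE; rewrite !tens_mul1D zE wE addrACA.
- by rewrite !tens_mul10 addr0.
- by move=> x' y'; rewrite -[tens _ _]/(tens_r x' y') !tens_mul1E mulrDl tens_rDr.
- by move=> z w zE wE; rewrite !tens_mul1D zE wE addrACA.
- by rewrite !tens_mul10.
- move=> x' y'; rewrite -[tens _ _]/(tens_r x' y') !tens_mul1E !alg_ofZ.
  by rewrite -!mulrA tens_r_bal.
- by move=> z w zE wE; rewrite !tens_mul1D zE wE.
Qed.

Lemma tens_mul_r x y w : tens_mul (tens_r x y) w = tens_mul1 x y w.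
Proof. by rewrite [LHS]tens_lift_tens //; exact: tens_mul_balanced. Qed.

Lemma tens_mulE x y x' y' :
  tens_mul (tens_r x y) (tens_r x' y') = tens_r (x * x') (y * y').
Proof. by rewrite tens_mul_r tens_mul1E. Qed.

Lemma tens_mulDl : left_distributive tens_mul +%R.
Proof. by move=> z z' w; exact/tens_liftD/tens_mul_balanced. Qed.

Lemma tens_mul0l w : tens_mul 0 w = 0.
Proof. exact/tens_lift0/tens_mul_balanced. Qed.

Lemma tensor_ring_ind (K : tensor_ring -> Prop) :
  K 0 -> (forall x y, K (tens_r x y)) ->
  (forall z w, K z -> K w -> K (z + w)) -> forall z, K z.
Proof.
move=> K0 Kt KD; exact: (@tensor_ind R (alg_of f) (alg_of g) K K0 Kt KD).
Qed.

Lemma tens_mulC : commutative tens_mul.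
Proof.
have m0 z : tens_mul z 0 = 0.
  elim/tensor_ring_ind: z => [|x y|z w zE wE]; first exact: tens_mul0l.
    by rewrite tens_mul_r tens_mul10.
  by rewrite tens_mulDl zE wE addr0.
have mD z w w' : tens_mul z (w + w') = tens_mul z w + tens_mul z w'.
  elim/tensor_ring_ind: z => [|x y|z1 z2 z1E z2E].
  - by rewrite !tens_mul0l addr0.
  - by rewrite !tens_mul_r tens_mul1D.
  - by rewrite !tens_mulDl z1E z2E addrACA.
elim/tensor_ring_ind=> [|x y|z1 z2 z1E z2E] w.
- by rewrite tens_mul0l m0.
- elim/tensor_ring_ind: w => [|x' y'|w1 w2 w1E w2E].
  + by rewrite tens_mul0l m0.
  + by rewrite !tens_mulE mulrC (mulrC y).
  + by rewrite tens_mulDl mD w1E w2E.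
- by rewrite tens_mulDl mD z1E z2E.
Qed.

Lemma tens_mulDr : right_distributive tens_mul +%R.
Proof. by move=> z w w'; rewrite !(tens_mulC z) tens_mulDl. Qed.

Fact tens_mulA : associative tens_mul.
Proof.
have m0 z : tens_mul z 0 = 0 by rewrite tens_mulC tens_mul0l.
elim/tensor_ring_ind=> [|x y|z1 z2 z1E z2E] w v.
- by rewrite !tens_mul0l.
- elim/tensor_ring_ind: w => [|x' y'|w1 w2 w1E w2E].
  + by rewrite !(tens_mul0l, m0).
  + elim/tensor_ring_ind: v => [|x3 y3|v1 v2 v1E v2E].
    * by rewrite !m0.
    * by rewrite !tens_mulE !mulrA.
    * by rewrite !tens_mulDr v1E v2E.
  + by rewrite !(tens_mulDl, tens_mulDr) w1E w2E.
- by rewrite !tens_mulDl z1E z2E.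
Qed.

Fact tens_mul1r : left_id (tens_r 1 1) tens_mul.
Proof.
elim/tensor_ring_ind=> [|x y|z w zE wE].
- by rewrite tens_mulC tens_mul0l.
- by rewrite tens_mulE !mul1r.
- by rewrite tens_mulDr zE wE.
Qed.

HB.instance Definition _ := GRing.Zmodule_isComPzRing.Build tensor_ring
  tens_mulA tens_mulC tens_mul1r tens_mulDl.

Lemma tens_rM x y x' y' :
  tens_r x y * tens_r x' y' = tens_r (x * x') (y * y').
Proof. exact: tens_mulE. Qed.

Definition tens_inl (x : S) : tensor_ring := tens_r x 1.
Definition tens_inr (y : T) : tensor_ring := tens_r 1 y.

Fact tens_inl_is_zmod : zmod_morphism tens_inl.
Proof.
move=> x y; apply: (canRL (addrK _)).
by rewrite /tens_inl -tens_rDl subrK.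
Qed.
Fact tens_inl_is_monoid : monoid_morphism tens_inl.
Proof. by split=> // x y; rewrite tens_rM mul1r. Qed.
HB.instance Definition _ :=
  GRing.isZmodMorphism.Build S tensor_ring tens_inl tens_inl_is_zmod.
HB.instance Definition _ :=
  GRing.isMonoidMorphism.Build S tensor_ring tens_inl tens_inl_is_monoid.

Fact tens_inr_is_zmod : zmod_morphism tens_inr.
Proof.
move=> x y; apply: (canRL (addrK _)).
by rewrite /tens_inr -tens_rDr subrK.
Qed.
Fact tens_inr_is_monoid : monoid_morphism tens_inr.
Proof. by split=> // x y; rewrite tens_rM mul1r. Qed.
HB.instance Definition _ :=
  GRing.isZmodMorphism.Build T tensor_ring tens_inr tens_inr_is_zmod.
HB.instance Definition _ :=
  GRing.isMonoidMorphism.Build T tensor_ring tens_inr tens_inr_is_monoid.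

Lemma tens_inlr (a : R) : tens_inl (f a) = tens_inr (g a).
Proof.
by rewrite /tens_inl /tens_inr -[f a]mulr1 tens_r_bal mulr1.
Qed.

Section RingLift.
Variables (D : comPzRingType) (u : {rmorphism S -> D}) (v : {rmorphism T -> D}).

Definition tens_ring_lift of u \o f =1 v \o g : tensor_ring -> D :=
  tens_lift (fun (x : alg_of f) (y : alg_of g) => u x * v y).

Variable uv : u \o f =1 v \o g.

Lemma tens_ring_lift_balanced :
  balanced (fun (x : alg_of f) (y : alg_of g) => u x * v y).
Proof.
split=> [x x' y|x y y'|a x y]; first by rewrite rmorphD mulrDl.
  by rewrite rmorphD mulrDr.
by rewrite !alg_ofZ !rmorphM /= [u (f a)]uv /= mulrCA mulrA.
Qed.

Lemma tens_ring_liftE x y : tens_ring_lift uv (tens_r x y) = u x * v y.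
Proof.
exact: (@tens_lift_tens _ (alg_of f) (alg_of g) _ _ tens_ring_lift_balanced).
Qed.

Lemma tens_ring_liftD z w :
  tens_ring_lift uv (z + w) = tens_ring_lift uv z + tens_ring_lift uv w.
Proof. exact/tens_liftD/tens_ring_lift_balanced. Qed.

Lemma tens_ring_lift0 : tens_ring_lift uv 0 = 0.
Proof. exact/tens_lift0/tens_ring_lift_balanced. Qed.

Fact tens_ring_lift_is_zmod : zmod_morphism (tens_ring_lift uv).
Proof.
move=> z w; apply: (canRL (addrK _)).
by rewrite -tens_ring_liftD subrK.
Qed.

Fact tens_ring_lift_is_monoid : monoid_morphism (tens_ring_lift uv).
Proof.
split=> [|z w]; first by rewrite tens_ring_liftE !rmorph1 mulr1.
elim/tensor_ring_ind: z => [|x y|z1 z2 z1E z2E].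
- by rewrite mul0r tens_ring_lift0 mul0r.
- elim/tensor_ring_ind: w => [|x' y'|w1 w2 w1E w2E].
  + by rewrite mulr0 tens_ring_lift0 mulr0.
  + by rewrite tens_rM !tens_ring_liftE !rmorphM mulrACA.
  + by rewrite mulrDr !tens_ring_liftD mulrDr w1E w2E.
- by rewrite mulrDl !tens_ring_liftD mulrDl z1E z2E.
Qed.

HB.instance Definition _ := GRing.isZmodMorphism.Build tensor_ring D
  (tens_ring_lift uv) tens_ring_lift_is_zmod.
HB.instance Definition _ := GRing.isMonoidMorphism.Build tensor_ring D
  (tens_ring_lift uv) tens_ring_lift_is_monoid.

End RingLift.

End TensorRing.

Section Ideals.
Variable R : comPzRingType.
Implicit Types I J P : set R.

Definition is_ideal I : Prop :=
  [/\ I 0, forall x y, I x -> I y -> I (x + y) &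
      forall a x, I x -> I (a * x)].

Definition is_prime P : Prop :=
  [/\ is_ideal P, ~ P 1 & forall x y, P (x * y) -> P x \/ P y].

Definition is_maximal I : Prop :=
  [/\ is_ideal I, ~ I 1 &
      forall J, is_ideal J -> ~ J 1 -> I `<=` J -> J = I].

Definition gen_ideal n (g : 'I_n -> R) : set R :=
  [set x | exists c : 'I_n -> R, x = \sum_i c i * g i].

Definition noetherian : Prop :=
  forall I, is_ideal I -> exists n (g : 'I_n -> R), I = gen_ideal g.

Record spec := Spec { spec_set :> set R ; specP : is_prime spec_set }.

Definition prime_chain d (c : 'I_d.+1 -> spec) : Prop :=
  forall i j : 'I_d.+1, (i < j)%N -> (c i : set R) `<` c j.

Definition krull_dim d : Prop :=
  (exists c : 'I_d.+1 -> spec, prime_chain c) /\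
  (forall n (c : 'I_n.+1 -> spec), prime_chain c -> (n <= d)%N).

Definition regular_local : Prop :=
  noetherian /\
  exists m : set R,
    [/\ is_maximal m, forall m', is_maximal m' -> m' = m &
        exists2 d, krull_dim d & exists g : 'I_d -> R, m = gen_ideal g].

Fact zero_is_ideal : is_ideal [set 0].
Proof.
by split=> //= [x y -> ->|a x ->]; rewrite ?addr0 ?mulr0.
Qed.

End Ideals.

(* The ring of fractions (R / I)_P : a pair (a, s) stands for a / s. *)
Section Fractions.
Variables (R : comPzRingType) (P : spec R) (I : set R) (idI : is_ideal I).

Definition denom : Type := {s : R | s \notin (P : set R)}.
HB.instance Definition _ := Choice.on denom.

Lemma denomP (s : denom) : ~ spec_set P (val s).
Proof. by move/mem_set=> Ps; move: (valP s); rewrite Ps. Qed.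

Definition Denom s (Ps : ~ spec_set P s) : denom :=
  exist _ s (introN idP (fun h => Ps (set_mem h))).

Definition denom1 : denom.
Proof. by apply: (@Denom 1); case: (specP P). Defined.

Definition denomM (s t : denom) : denom.
Proof.
apply: (@Denom (val s * val t)).
by case: (specP P) => _ _ prP /prP[]; exact: denomP.
Defined.

Definition frac_eqb (u v : R * denom) : bool :=
  `[< exists w : denom, I (val w * (u.1 * val v.2 - v.1 * val u.2)) >].

Lemma idealN x : I x -> I (- x).
Proof. by case: idI => _ _ IM Ix; rewrite -mulN1r; exact: IM. Qed.

Fact frac_eqb_refl : reflexive frac_eqb.
Proof.
move=> u; apply/asboolP; exists denom1; rewrite subrr mulr0.
by case: idI.
Qed.

Fact frac_eqb_sym : symmetric frac_eqb.
Proof.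
by move=> u v; apply/asboolP/asboolP=> -[w /idealN Iw]; exists w;
  rewrite -opprB mulrN.
Qed.

Fact frac_eqb_trans : transitive frac_eqb.
Proof.
case: idI => _ ID IM.
move=> v u t /asboolP[w Iw] /asboolP[w' Iw']; apply/asboolP.
exists (denomM (denomM w w') v.2).
have := ID _ _ (IM (val w' * val t.2) _ Iw) (IM (val w * val u.2) _ Iw').
by congr I => /=; ring.
Qed.

Canonical frac_equiv :=
  EquivRel frac_eqb frac_eqb_refl frac_eqb_sym frac_eqb_trans.

Definition frac_ring : Type := {eq_quot frac_eqb}.
HB.instance Definition _ := Choice.on frac_ring.
HB.instance Definition _ : EqQuotient _ frac_eqb frac_ring :=
  EqQuotient.on frac_ring.

Definition frac (a : R) (s : denom) : frac_ring := \pi_frac_ring (a, s).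

Lemma fracP a s b t : frac a s = frac b t <->
  exists w : denom, I (val w * (a * val t - b * val s)).
Proof.
rewrite /frac; split=> [/eqmodP/asboolP // | h].
by apply/eqmodP/asboolP.
Qed.

Lemma fracW (K : frac_ring -> Prop) :
  (forall a s, K (frac a s)) -> forall z, K z.
Proof.
by move=> Kf z; rewrite -(reprK z); case: (repr z) => a s; exact: Kf.
Qed.

Lemma frac_repr z : frac (repr z).1 (repr z).2 = z.
Proof. by rewrite /frac -surjective_pairing reprK. Qed.

Definition frac_add (z w : frac_ring) : frac_ring :=
  frac ((repr z).1 * val (repr w).2 + (repr w).1 * val (repr z).2)
       (denomM (repr z).2 (repr w).2).
Definition frac_opp (z : frac_ring) := frac (- (repr z).1) (repr z).2.
Definition frac_mul (z w : frac_ring) : frac_ring :=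
  frac ((repr z).1 * (repr w).1) (denomM (repr z).2 (repr w).2).

Lemma frac_addE a s b t : frac_add (frac a s) (frac b t) =
  frac (a * val t + b * val s) (denomM s t).
Proof.
case: (idI) => _ ID IM; rewrite /frac_add.
have /fracP[w Iw] := frac_repr (frac a s).
have /fracP[w' Iw'] := frac_repr (frac b t).
move: (repr (frac a s)) (repr (frac b t)) Iw Iw' => [a' s'] [b' t'] /= Iw Iw'.
apply/fracP; exists (denomM w w').
have := ID _ _ (IM (val w' * val t * val t') _ Iw)
               (IM (val w * val s * val s') _ Iw').
by congr I => /=; ring.
Qed.

Lemma frac_oppE a s : frac_opp (frac a s) = frac (- a) s.
Proof.
rewrite /frac_opp.
have /fracP[w Iw] := frac_repr (frac a s).
move: (repr (frac a s)) Iw => [a' s'] /= Iw.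
apply/fracP; exists w; have := idealN Iw.
by congr I => /=; ring.
Qed.

Lemma frac_mulE a s b t :
  frac_mul (frac a s) (frac b t) = frac (a * b) (denomM s t).
Proof.
case: (idI) => _ ID IM; rewrite /frac_mul.
have /fracP[w Iw] := frac_repr (frac a s).
have /fracP[w' Iw'] := frac_repr (frac b t).
move: (repr (frac a s)) (repr (frac b t)) Iw Iw' => [a' s'] [b' t'] /= Iw Iw'.
apply/fracP; exists (denomM w w').
have := ID _ _ (IM (val w' * val t * b') _ Iw)
               (IM (val w * a * val s') _ Iw').
by congr I => /=; ring.
Qed.

Lemma frac_eq a s b t : a * val t = b * val s -> frac a s = frac b t.
Proof.
move=> e; apply/fracP; exists denom1; rewrite e subrr mulr0.
by case: idI.
Qed.

Fact frac_addA : associative frac_add.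
Proof.
elim/fracW=> a s; elim/fracW=> b t; elim/fracW=> c u.
by rewrite !frac_addE; apply: frac_eq => /=; ring.
Qed.

Fact frac_addC : commutative frac_add.
Proof.
elim/fracW=> a s; elim/fracW=> b t.
by rewrite !frac_addE; apply: frac_eq => /=; ring.
Qed.

Fact frac_add0 : left_id (frac 0 denom1) frac_add.
Proof.
by elim/fracW=> a s; rewrite !frac_addE; apply: frac_eq => /=; ring.
Qed.

Fact frac_addN : left_inverse (frac 0 denom1) frac_opp frac_add.
Proof.
elim/fracW=> a s; rewrite frac_oppE frac_addE; apply: frac_eq => /=; ring.
Qed.

HB.instance Definition _ :=
  GRing.isZmodule.Build frac_ring frac_addA frac_addC frac_add0 frac_addN.

Fact frac_mulA : associative frac_mul.
Proof.
elim/fracW=> a s; elim/fracW=> b t; elim/fracW=> c u.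
by rewrite !frac_mulE; apply: frac_eq => /=; ring.
Qed.

Fact frac_mulC : commutative frac_mul.
Proof.
elim/fracW=> a s; elim/fracW=> b t.
by rewrite !frac_mulE; apply: frac_eq => /=; ring.
Qed.

Fact frac_mul1 : left_id (frac 1 denom1) frac_mul.
Proof.
by elim/fracW=> a s; rewrite !frac_mulE; apply: frac_eq => /=; ring.
Qed.

Fact frac_mulDl : left_distributive frac_mul +%R.
Proof.
elim/fracW=> a s; elim/fracW=> b t; elim/fracW=> c u.
rewrite -[frac a s + _]/(frac_add _ _) -[RHS]/(frac_add _ _).
by rewrite !(frac_addE, frac_mulE); apply: frac_eq => /=; ring.
Qed.

HB.instance Definition _ := GRing.Zmodule_isComPzRing.Build frac_ring
  frac_mulA frac_mulC frac_mul1 frac_mulDl.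

Definition to_frac (a : R) : frac_ring := frac a denom1.

Fact to_frac_is_zmod : zmod_morphism to_frac.
Proof.
move=> a b; apply: (canRL (addrK _)).
rewrite -[_ + to_frac b]/(frac_add _ _) frac_addE.
by apply: frac_eq => /=; ring.
Qed.

Fact to_frac_is_monoid : monoid_morphism to_frac.
Proof.
split=> // a b; rewrite -[RHS]/(frac_mul _ _) frac_mulE.
by apply: frac_eq => /=; ring.
Qed.

HB.instance Definition _ :=
  GRing.isZmodMorphism.Build R frac_ring to_frac to_frac_is_zmod.
HB.instance Definition _ :=
  GRing.isMonoidMorphism.Build R frac_ring to_frac to_frac_is_monoid.

End Fractions.

Definition localization (R : comPzRingType) (P : spec R) : comPzRingType :=
  frac_ring P (@zero_is_ideal R).

Definition spec_ideal (R : comPzRingType) (P : spec R) : is_ideal P :=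
  let: And3 h _ _ := specP P in h.

(* kappa(P), as (R / P)_P, that is the fraction field of R / P. *)
Section ResidueField.
Variables (R : comPzRingType) (P : spec R).

Definition residue_field : Type := frac_ring P (spec_ideal P).
HB.instance Definition _ := GRing.ComPzRing.on residue_field.

Lemma residue_eq0 a (s : denom P) :
  frac (spec_ideal P) a s = 0 :> residue_field <-> spec_set P a.
Proof.
have [[_ _ PM] P1 prP] := specP P.
split=> [/fracP[w /=]|Pa].
  by rewrite mulr1 mul0r subr0 => /prP[/denomP//|].
by apply/fracP; exists (denom1 P); rewrite /= mulr1 mul0r subr0 mul1r.
Qed.

Fact residue_neq0 : 1 != 0 :> residue_field.
Proof.
by apply/eqP=> /residue_eq0; case: (specP P).
Qed.

HB.instance Definition _ :=
  GRing.PzSemiRing_isNonZero.Build residue_field residue_neq0.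

Definition residue_inv (z : residue_field) : residue_field :=
  match pselect (spec_set P (repr z).1) with
  | left _ => 0
  | right nP => frac (spec_ideal P) (val (repr z).2) (Denom nP)
  end.

Fact residue_mulV z : z != 0 -> residue_inv z * z = 1.
Proof.
move=> z0; rewrite /residue_inv; case: pselect => [Pz|nP].
  case/eqP: z0; rewrite -(frac_repr z); exact/residue_eq0.
rewrite -[X in _ * X](frac_repr z) -[LHS]/(frac_mul _ _) frac_mulE.
by apply: frac_eq => /=; rewrite mulr1 mul1r mulrC.
Qed.

Fact residue_inv0 : residue_inv 0 = 0.
Proof.
rewrite /residue_inv; case: pselect => // nP; case: nP.
by apply/(residue_eq0 _ (repr (0 : residue_field)).2); exact: frac_repr.
Qed.

HB.instance Definition _ := GRing.ComNzRing_isField.Build residue_field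
  residue_mulV residue_inv0.

Definition to_residue : R -> residue_field := to_frac P (spec_ideal P).
HB.instance Definition _ := GRing.RMorphism.copy to_residue
  (to_frac P (spec_ideal P)).

End ResidueField.

Definition regular_ring (R : comPzRingType) : Prop :=
  noetherian R /\ forall P : spec R, regular_local (localization P).

(* [fieldExtType k] ranges over the finite field extensions of [k]. *)
Definition geometrically_regular (k : fieldType) (R : comPzRingType)
    (g : {rmorphism k -> R}) : Prop :=
  forall L : fieldExtType k, regular_ring (tensor_ring (GRing.in_alg L) g).

Section Homomorphisms.
Variables (A B : comPzRingType) (f : {rmorphism A -> B}).

Definition fiber (P : spec A) : comPzRingType := tensor_ring (to_residue P) f.

Definition to_fiber (P : spec A) : {rmorphism residue_field P -> fiber P} :=
  tens_inl (to_residue P) f.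

Definition almost_quasi_finite : Prop :=
  forall P : spec A, module_finite (to_fiber P).

Definition regular_rmorphism : Prop :=
  flat_rmorphism f /\ forall P : spec A, geometrically_regular (to_fiber P).

End Homomorphisms.

Section Frobenius.
Variables (p : nat) (R : comPzRingType).

Definition frobenius (e : nat) (pr_p : prime p) (chR : p%:R = 0 :> R) (a : R) :=
  a ^+ (p ^ e).

Variables (e : nat) (pr_p : prime p) (chR : p%:R = 0 :> R).

Lemma exprD_char (a b : R) : (a + b) ^+ p = a ^+ p + b ^+ p.
Proof.
have defp := prednK (prime_gt0 pr_p).
rewrite exprDn big_ord_recr subnn -defp big_ord_recl /= defp.
rewrite subn0 mulr1 mul1r bin0 binn big1 ?addr0 // => i _.
rewrite -mulr_natl.
have /dvdnP[q ->] : (p %| 'C(p, bump 0 i))%N.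
  by apply: prime_dvd_bin; rewrite //= -{2}defp ltnS (valP i).
by rewrite natrM chR mulr0 mul0r.
Qed.

Fact frobenius_is_nmod : nmod_morphism (frobenius e pr_p chR).
Proof.
rewrite /frobenius; split=> [|a b].
  by rewrite expr0n expn_eq0 (gtn_eqF (prime_gt0 pr_p)).
elim: e a b => [|n IHn] a b; first by rewrite expn0 !expr1.
by rewrite expnS !exprM exprD_char IHn.
Qed.

Fact frobenius_is_monoid : monoid_morphism (frobenius e pr_p chR).
Proof.
by split=> [|a b]; rewrite /frobenius ?expr1n ?exprMn.
Qed.

HB.instance Definition _ := GRing.isNmodMorphism.Build R R
  (frobenius e pr_p chR) frobenius_is_nmod.
HB.instance Definition _ := GRing.isMonoidMorphism.Build R R
  (frobenius e pr_p chR) frobenius_is_monoid.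

End Frobenius.

Section RaduAndre.
Variables (p : nat) (pr_p : prime p) (A B : comPzRingType).
Variables (chA : p%:R = 0 :> A) (chB : p%:R = 0 :> B).
Variable f : {rmorphism A -> B}.

(* B^(e) (x)_{A^(e)} A: the copies A^(e), B^(e) are A, B themselves, and A is
   an A^(e)-algebra through the e-th iterate of its Frobenius. *)
Definition radu_andre_source (e : nat) : comPzRingType :=
  tensor_ring f (frobenius e pr_p chA).

Fact radu_andre_comp e :
  frobenius e pr_p chB \o f =1 f \o frobenius e pr_p chA.
Proof. by move=> a; rewrite /= /frobenius rmorphXn. Qed.

Definition radu_andre (e : nat) : {rmorphism radu_andre_source e -> B} :=
  tens_ring_lift (radu_andre_comp e).

Lemma radu_andreE e (b : B) (a : A) :
  radu_andre e (tens_r f (frobenius e pr_p chA) b a) = b ^+ (p ^ e) * f a.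
Proof. exact: tens_ring_liftE. Qed.

Fact radu_andre_inr e :
  radu_andre e \o tens_inr f (frobenius e pr_p chA) =1 f.
Proof. by move=> a; rewrite /= radu_andreE expr1n mul1r. Qed.

Definition F_pure : Prop :=
  forall e, (1 <= e)%N -> pure_rmorphism (radu_andre e).

(* [radu_andre e] as an A-linear map, A acting on its source through the
   second tensor factor. *)
Definition dumitrescu : Prop :=
  forall e, (1 <= e)%N -> pure_linear (alg_linear (radu_andre_inr e)).

End RaduAndre.

(* Main.v *)
From HB Require Import structures.
Require Import Defs.
From mathcomp Require Import all_boot all_order all_algebra all_field.
From mathcomp Require Import boolp classical_sets.
From mathcomp Require Import ring.

(* Let S_e denote the source of Phi_e.

   Over a prime P the fibre is a finite kappa(P)-algebra with a basis of the
   form 1 (x) b_i, and it is geometrically regular if and only if the q-th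
   powers 1 (x) b_i^q (q = p^e) are again linearly independent: adjoining q-th
   roots of the coefficients turns a linear relation between them into a
   nilpotent element.

   Both regularity and purity make S_e / I S_e -> B / I B injective for every
   ideal I of A: purity directly, and regularity by noetherian induction on I,
   flatness handling the non-prime I and the fibre handling the prime ones.
   With this injectivity, noetherian induction also shows that Phi_e is
   surjective; hence (1) implies that Phi_e is bijective, and so does (3).

   Conversely suppose that Phi_e is bijective modulo every ideal. Modulo the
   Frobenius power P^[q], the ring B is a base change of its fibre at P along
   the map A / P -> A / P^[q] induced by the Frobenius, hence it is generically
   free over A / P^[q] with basis the b_i^q. The theorems of Artin-Rees (in A)
   and Krull (in B) then yield (I B : x) = (I : x) B for all ideals I of A and
   all x in A, which is flatness. *)

Set Implicit Arguments.
Unset Strict Implicit.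
Unset Printing Implicit Defensive.

Import GRing.Theory.
Local Open Scope ring_scope.
Local Open Scope quotient_scope.
Local Open Scope classical_set_scope.

(** * Ideals in noetherian rings *)

Section IdealTheory.
Variable R : comPzRingType.
Implicit Types (I J P : set R) (x y z : R).

(** The obstacle is finiteness: B is finite over A only fibrewise and S_e is not known to be
    noetherian, so Nakayama's lemma cannot carry a statement from the fibres to A. What a fibre
    gives is information up to a multiplier outside P. The noetherian induction turns it into an
    honest statement, and for surjectivity the missing finiteness comes from B being noetherian: the
    elements of B that are torsion modulo PB form an ideal of B, so one element outside P kills them
    all. Frobenius powers enter because an element of P crosses the tensor sign of S_e as its q-th
    power. Hence S_e / P^[q] S_e depends only on B / PB, while P^[q] still shrinks like the powers
    of P, P being finitely generated. This is why flatness uses arbitrarily large e, whereas e = 1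
    decides the fibres. A finite algebra over a field has dimension zero, where regular means
    reduced; so geometric regularity becomes a question about nilpotents. *)

Definition ideal_add I x : set R := [set z | exists2 i, I i & exists a, z = i + a * x].
Definition colon I x : set R := [set z | I (z * x)].

Lemma idealB I x y : is_ideal I -> I x -> I y -> I (x - y).
Proof. by move=> idI Ix Iy; case: (idI) => _ ID _; apply: ID => //; apply: idealN. Qed.

Lemma ideal_sum I n (F : 'I_n -> R) :
  is_ideal I -> (forall i, I (F i)) -> I (\sum_i F i).
Proof. by case=> I0 ID _ IF; elim/big_ind: _. Qed.

Lemma ideal_add_is_ideal I x : is_ideal I -> is_ideal (ideal_add I x).
Proof.
case=> I0 ID IM; split=> [|_ _ [i Ii [a ->]] [j Ij [b ->]]|a _ [i Ii [b ->]]].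
- by exists 0 => //; exists 0; rewrite mul0r addr0.
- by exists (i + j); [exact: ID|exists (a + b); ring].
- by exists (a * i); [exact: IM|exists (a * b); ring].
Qed.

Lemma colon_is_ideal I x : is_ideal I -> is_ideal (colon I x).
Proof.
case=> I0 ID IM; split=> [|y z|a y]; rewrite /colon /=.
- by rewrite mul0r.
- by rewrite mulrDl; exact: ID.
- by rewrite -mulrA; exact: IM.
Qed.

Lemma sub_ideal_add I x : is_ideal I -> I `<=` ideal_add I x.
Proof. by move=> idI i Ii; exists i => //; exists 0; rewrite mul0r addr0. Qed.

Lemma mem_ideal_add I x : is_ideal I -> ideal_add I x x.
Proof. by case=> I0 _ _; exists 0 => //; exists 1; rewrite mul1r add0r. Qed.

Lemma proper_ideal_add I x : is_ideal I -> ~ I x -> I `<` ideal_add I x.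
Proof.
move=> idI nIx; split; first exact: sub_ideal_add.
by move=> /(_ x (mem_ideal_add x idI)).
Qed.

Lemma gen_ideal_mem n (g : 'I_n -> R) i : gen_ideal g (g i).
Proof.
exists (fun j => (j == i)%:R); rewrite (bigD1 i) //= eqxx mul1r big1 ?addr0 //.
by move=> j /negPf->; rewrite mul0r.
Qed.

Lemma gen_ideal_sub I n (g : 'I_n -> R) :
  is_ideal I -> (forall i, I (g i)) -> gen_ideal g `<=` I.
Proof.
move=> idI Ig _ [c ->]; apply: ideal_sum => // i.
by case: idI => _ _; apply.
Qed.

(** A counterexample would start, by choice, a strictly ascending chain of counterexamples; the
    union of the chain is finitely generated, hence already reached at a finite stage. *)
Lemma noetherian_ind (K : set R -> Prop) : noetherian R ->
  (forall I, is_ideal I -> (forall J, is_ideal J -> I `<` J -> K J) -> K I) ->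
  forall I, is_ideal I -> K I.
Proof.
move=> noethR step I0 idI0; apply: contrapT => nK.
pose T := {I | is_ideal I /\ ~ K I}.
have next (t : T) : exists u : T, sval t `<` sval u.
  apply: contrapT => nu; case: t nu => I [idI nKI] /= nu.
  apply: nKI; apply: step => // J idJ IJ; apply: contrapT => nKJ.
  by apply: nu; exists (exist _ J (conj idJ nKJ)).
have [s Ps] := choice next.
pose u n : T := iter n s (exist _ I0 (conj idI0 nK)).
have id_u n : is_ideal (sval (u n)) by case: (svalP (u n)).
have mono m n : (m <= n)%N -> sval (u m) `<=` sval (u n).
  move=> /subnKC<-; elim: (n - m)%N => [|d IHd]; first by rewrite addn0.
  by rewrite addnS; apply: subset_trans IHd _; case: (Ps (u (m + d)%N)).
have idU : is_ideal [set x | exists n, sval (u n) x].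
  split=> [|x y [m mx] [n ny]|a x [n nx]].
  - by exists 0%N; case: (id_u 0%N).
  - exists (maxn m n); case: (id_u (maxn m n)) => _ ID _; apply: ID.
      exact: mono (leq_maxl _ _) _ mx.
    exact: mono (leq_maxr _ _) _ ny.
  - by exists n; case: (id_u n) => _ _; apply.
have [n [g Ug]] := noethR _ idU.
have /choice[k gk] : forall i, exists k, sval (u k) (g i).
  by move=> i; have : gen_ideal g (g i) := gen_ideal_mem g i; rewrite -Ug.
pose N := \max_i k i.
have [_] := Ps (u N); apply; rewrite -[s _]/(u N.+1).
move=> x ux; have : gen_ideal g x by rewrite -Ug; exists N.+1.
apply: gen_ideal_sub => // i.
exact: mono (leq_bigmax i) _ (gk i).
Qed.

Lemma not_prime_ideal I : is_ideal I -> ~ is_prime I ->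
  I 1 \/ exists x y, [/\ ~ I x, ~ I y & I (x * y)].
Proof.
move=> idI nprI; have [I1|nI1] := pselect (I 1); [by left|right].
apply: contrapT => nxy; apply: nprI; split=> // x y Ixy.
by apply: contrapT => /not_orP[nx ny]; apply: nxy; exists x, y.
Qed.

(** If x y lies in J, then J + (x) or J + (y) still avoids S: otherwise the product of an element of
    S from each would lie in both J and S. With S = {1} this puts a proper ideal into a prime. *)
Lemma prime_avoiding (S : set R) J : noetherian R ->
  S 1 -> (forall x y, S x -> S y -> S (x * y)) ->
  is_ideal J -> (forall x, J x -> ~ S x) ->
  exists2 Q, is_prime Q & J `<=` Q /\ (forall x, Q x -> ~ S x).
Proof.
move=> noethR S1 SM; move: J; refine (noetherian_ind noethR _) => J idJ IH JS.
have [prJ|nprJ] := pselect (is_prime J); first by exists J => //; split.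
have [J1|[x [y [nx ny Jxy]]]] := not_prime_ideal idJ nprJ.
  by case: (JS _ J1 S1).
have [dx|] := pselect (forall z, ideal_add J x z -> ~ S z).
  have [Q prQ [JQ QS]] := IH _ (ideal_add_is_ideal x idJ) (proper_ideal_add idJ nx) dx.
  by exists Q => //; split=> //; apply: subset_trans JQ; exact: sub_ideal_add.
have [dy _|] := pselect (forall z, ideal_add J y z -> ~ S z).
  have [Q prQ [JQ QS]] := IH _ (ideal_add_is_ideal y idJ) (proper_ideal_add idJ ny) dy.
  by exists Q => //; split=> //; apply: subset_trans JQ; exact: sub_ideal_add.
move=> /existsNP[t /not_implyP[[j' Jj' [b tE]] /contrapT St]].
move=> /existsNP[s /not_implyP[[j Jj [a sE]] /contrapT Ss]].
case: (JS (s * t)); last exact: SM.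
have [_ JD JM] := idJ.
have -> : s * t = t * j + (a * x) * j' + (a * b) * (x * y) by rewrite sE tE; ring.
by apply: (JD); [apply: (JD)|]; apply: JM.
Qed.

Lemma ideal_exp I x m n : is_ideal I -> (m <= n)%N -> I (x ^+ m) -> I (x ^+ n).
Proof.
by move=> [_ _ IM] /subnK<- Ix; rewrite exprD; apply: IM.
Qed.

(** The ideals (I : x^n) increase with n, and finitely many generators of their union lie in one of
    them. *)
Lemma colon_exp_stable I x : noetherian R -> is_ideal I ->
  exists n, forall m r, I (x ^+ (n + m) * r) -> I (x ^+ n * r).
Proof.
move=> noethR idI; have [I0 ID IM] := idI.
have idU : is_ideal [set r | exists n, I (x ^+ n * r)].
  split=> [|r r' [m mr] [n nr']|a r [n nr]].
  - by exists 0%N; rewrite mulr0.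
  - exists (m + n)%N; rewrite mulrDr; apply: ID.
      by rewrite exprD mulrAC mulrC; apply: IM.
    by rewrite exprD -mulrA; apply: IM.
  - by exists n; rewrite mulrCA; apply: IM.
have [k [g Ug]] := noethR _ idU.
have /choice[N gN] : forall i, exists n, I (x ^+ n * g i).
  by move=> i; have : gen_ideal g (g i) := gen_ideal_mem g i; rewrite -Ug.
exists (\max_i N i)%N => m r Ir.
have : gen_ideal g r by rewrite -Ug; exists (\max_i N i + m)%N.
case=> c ->; rewrite mulr_sumr; apply: ideal_sum => // i.
rewrite mulrCA; apply: (IM).
rewrite -(subnK (leq_bigmax i)) exprD -mulrA.
exact: IM.
Qed.

Definition frob_power (q : nat) P : set R :=
  [set z | exists n (c y : 'I_n -> R), (forall i, P (y i)) /\ z = \sum_i c i * y i ^+ q].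

Lemma frob_power_sub q P I : is_ideal I -> (forall y, P y -> I (y ^+ q)) ->
  frob_power q P `<=` I.
Proof.
move=> idI PI _ [n [c [y [Py ->]]]]; apply: ideal_sum => // i.
by case: idI => _ _; apply; apply: PI.
Qed.

Lemma frob_power_mem q P y : P y -> frob_power q P (y ^+ q).
Proof.
by move=> Py; exists 1%N, (fun=> 1), (fun=> y); rewrite big_ord1 mul1r.
Qed.

Lemma frob_power_is_ideal q P : is_ideal (frob_power q P).
Proof.
split=> [|_ _ [n [c [y [Py ->]]]] [n' [c' [y' [Py' ->]]]]|a _ [n [c [y [Py ->]]]]].
- by exists 0%N, (fun=> 0), (fun=> 0); split=> [[]//|]; rewrite big_ord0.
- exists (n + n')%N, (fun i => match split i with inl j => c j | inr j => c' j end),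
    (fun i => match split i with inl j => y j | inr j => y' j end).
  split=> [i|]; first by case: (split i).
  rewrite big_split_ord; congr (_ + _); apply: eq_bigr => i _.
    by rewrite (unsplitK (inl i)).
  by rewrite (unsplitK (inr i)).
- exists n, (fun i => a * c i), y; split=> //.
  by rewrite mulr_sumr; apply: eq_bigr => i _; rewrite mulrA.
Qed.

End IdealTheory.

(** * Frobenius powers and the Artin-Rees property *)

Section FrobeniusPower.
Variables (p : nat) (pr_p : prime p) (R : comPzRingType) (chR : p%:R = 0 :> R).

Lemma expr_sum_charn e n (F : 'I_n -> R) :
  (\sum_i F i) ^+ (p ^ e) = \sum_i F i ^+ (p ^ e).
Proof. exact: (rmorph_sum (frobenius e pr_p chR)). Qed.

(* This covers both Artin-Rees (E = I + P^[q] x, a = I + (x)) and Krull's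
   intersection theorem (E = L + Q y, a = L + (y)). An ideal H maximal with
   H `&` a `<=` E contains a power of every element of P. *)
Lemma artin_rees (E a P : set R) : noetherian R ->
  is_ideal E -> is_ideal a -> is_ideal P -> E `<=` a ->
  (forall x, P x -> exists c, forall y, a y -> E (x ^+ c * y)) ->
  exists e0, forall e, (e0 <= e)%N ->
    forall z, frob_power (p ^ e) P z -> a z -> E z.
Proof.
move=> noethR idE ida idP Ea PaE.
have [H idH [EH HaE Hmax]] : exists2 H, is_ideal H &
    [/\ E `<=` H, (forall z, H z -> a z -> E z) &
      forall x, ~ H x -> exists2 z, ideal_add H x z & a z /\ ~ E z].
  suff step : forall H, is_ideal H -> E `<=` H /\ (forall z, H z -> a z -> E z) ->
      exists2 H, is_ideal H & [/\ E `<=` H, (forall z, H z -> a z -> E z) &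
        forall x, ~ H x -> exists2 z, ideal_add H x z & a z /\ ~ E z].
    by apply: (step E idE); split.
  refine (noetherian_ind noethR _) => H idH IH [EH HaE].
  have [mx|] := pselect (forall x, ~ H x -> exists2 z, ideal_add H x z & a z /\ ~ E z).
    by exists H; [exact: idH|split].
  move=> /existsNP[x /not_implyP[nHx nz]].
  apply: (IH _ (ideal_add_is_ideal x idH) (proper_ideal_add idH nHx)).
  split; first by apply: subset_trans EH _; exact: sub_ideal_add.
  move=> z Hz az; apply: contrapT => nEz; apply: nz; exists z => //.
have [_ HD HM] := idH; have [_ aD aM] := ida.
have Ppow x : P x -> exists n, H (x ^+ n).
  move=> Px; have [c xc] := PaE _ Px.
  (* With n where (H : x^n) stabilizes, x^n lies in H: otherwise maximality yields z = h + r x^n in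
     [a] but not in [E], while x^c z in [E] puts x^(n+c) r, hence x^n r and z, into [H]. *)
  have [n nst] := colon_exp_stable x noethR idH; exists n.
  apply: contrapT => /Hmax[z [h Hh [r zE]] [az]]; apply.
  apply: HaE => //; rewrite zE; apply: HD => //.
  rewrite mulrC; apply: (nst c).
  have -> : x ^+ (n + c) * r = x ^+ c * z - x ^+ c * h by rewrite zE exprD; ring.
  by apply: idealB => //; [apply: EH; apply: xc|apply: HM].
have [k [g Pg]] := noethR _ idP.
have /choice[N gN] : forall i, exists n, H (g i ^+ n).
  by move=> i; apply: Ppow; rewrite Pg; exact: gen_ideal_mem.
(* By additivity of the Frobenius, the p^e-th power of a combination of the g_i is a combination of
   the g_i^(p^e). No factor for the number of generators is lost, and p^e > e makes the maximum
   large enough. *)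
exists (\max_i N i)%N => e Ne z Pz az; apply: HaE => //.
apply: frob_power_sub Pz => // y; rewrite Pg => -[c ->].
rewrite expr_sum_charn; apply: ideal_sum => // i.
rewrite exprMn; apply: HM; apply: ideal_exp (gN i) => //.
apply: leq_trans (leq_bigmax i) _; apply: leq_trans Ne _.
exact/ltnW/ltn_expl/prime_gt1.
Qed.

End FrobeniusPower.

(** * Colon ideals and flatness *)

Section IdealSpan.
Variables (R : comPzRingType) (X : set R) (M : lmodType R).

Inductive ispan : M -> Prop :=
| ispan0 : ispan 0
| ispan_cons a m x of X a & ispan x : ispan (a *: m + x).

Lemma ispanZ a m : X a -> ispan (a *: m).
Proof. by move=> Xa; rewrite -[a *: m]addr0; apply: ispan_cons Xa ispan0. Qed.

Lemma ispanD x y : ispan x -> ispan y -> ispan (x + y).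
Proof.
elim=> [|a m z Xa _ IH] Iy; first by rewrite add0r.
by rewrite -addrA; apply: ispan_cons Xa (IH Iy).
Qed.

Lemma ispan_scale c x : ispan x -> ispan (c *: x).
Proof.
elim=> [|a m z Xa _ IH]; first by rewrite scaler0; exact: ispan0.
by rewrite scalerDr scalerA mulrC -scalerA; apply: ispan_cons.
Qed.

Lemma ispanN x : ispan x -> ispan (- x).
Proof. by rewrite -scaleN1r; exact: ispan_scale. Qed.

Lemma ispanB x y : ispan x -> ispan y -> ispan (x - y).
Proof. by move=> Ix /ispanN; exact: ispanD. Qed.

Lemma ispan_sum n (F : 'I_n -> M) : (forall i, ispan (F i)) -> ispan (\sum_i F i).
Proof. by move=> IF; elim/big_ind: _ => //; [exact: ispan0|exact: ispanD]. Qed.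

End IdealSpan.

Section IdealSpanTheory.
Variables (R : comPzRingType).
Implicit Types (X Y I : set R).

Lemma ispan_ispan X Y (M : lmodType R) (x : M) :
  (forall a, X a -> forall m, @ispan R Y M (a *: m)) -> ispan X x -> ispan Y x.
Proof.
by move=> XY; elim=> [|a m z Xa _ IH]; [exact: ispan0|apply: ispanD => //; apply: XY].
Qed.

Lemma ispan_sub X Y (M : lmodType R) (x : M) : X `<=` Y -> ispan X x -> ispan Y x.
Proof. by move=> XY; apply: ispan_ispan => a Xa m; apply/ispanZ/XY. Qed.

Lemma ispan_linear X (M N : lmodType R) (h : {linear M -> N}) x :
  ispan X x -> ispan X (h x).
Proof.
elim=> [|a m z Xa _ IH]; first by rewrite linear0; exact: ispan0.
by rewrite linearP; apply: ispan_cons.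
Qed.

Lemma ispan_eq0 (M : lmodType R) (x : M) : ispan [set 0] x -> x = 0.
Proof. by elim=> // a m z -> _ ->; rewrite scale0r addr0. Qed.

Lemma ispan1 X (M : lmodType R) (x : M) : X 1 -> ispan X x.
Proof. by move=> X1; rewrite -(scale1r x); exact: ispanZ. Qed.

Lemma ispan_ideal_add I (M : lmodType R) a (x : M) : is_ideal I ->
  ispan (ideal_add I a) x -> exists m, ispan I (x - a *: m).
Proof.
move=> idI; elim=> [|_ m z [i Ii [b ->]] _ [m' zE]].
  by exists 0; rewrite scaler0 subr0; exact: ispan0.
exists (b *: m + m').
have -> : (i + b * a) *: m + z - a *: (b *: m + m') = i *: m + (z - a *: m').
  rewrite scalerDl scalerDr scalerA (mulrC b) opprD -!addrA; congr (_ + _).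
  by rewrite (addrCA z) addNKr.
by apply: ispanD => //; exact: ispanZ.
Qed.

Lemma ispan_add_mem I (M : lmodType R) a (x m : M) : is_ideal I ->
  ispan I (x - a *: m) -> ispan (ideal_add I a) x.
Proof.
move=> idI Ix; rewrite -(subrK (a *: m) x); apply: ispanD.
  by apply: ispan_sub Ix; exact: sub_ideal_add.
by apply: ispanZ; exact: mem_ideal_add.
Qed.

End IdealSpanTheory.

(** * The quotients M / IM and their description as tensor products *)

Section QuotientModule.
Variables (R : comPzRingType) (X : set R) (M : lmodType R).

Definition iquo_eqb (x y : M) : bool := `[< ispan X (x - y) >].

Fact iquo_eqb_refl : reflexive iquo_eqb.
Proof. by move=> x; apply/asboolP; rewrite subrr; exact: ispan0. Qed.
Fact iquo_eqb_sym : symmetric iquo_eqb.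
Proof. by move=> x y; apply/asboolP/asboolP => /ispanN; rewrite opprB. Qed.
Fact iquo_eqb_trans : transitive iquo_eqb.
Proof.
move=> y x z /asboolP xy /asboolP yz; apply/asboolP.
by have := ispanD xy yz; rewrite subrKA.
Qed.

Canonical iquo_equiv := EquivRel iquo_eqb iquo_eqb_refl iquo_eqb_sym iquo_eqb_trans.

(* M / X M, with the submodule X M given by [ispan X]. *)
Definition iquo : Type := {eq_quot iquo_eqb}.
HB.instance Definition _ := Choice.on iquo.
HB.instance Definition _ : EqQuotient _ iquo_eqb iquo := EqQuotient.on iquo.

Definition to_iquo (x : M) : iquo := \pi_iquo x.

Lemma iquoP x y : to_iquo x = to_iquo y <-> ispan X (x - y).
Proof.
rewrite /to_iquo; split=> [/eqmodP/asboolP // | h].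
by apply/eqmodP/asboolP.
Qed.

Lemma iquo_repr z : to_iquo (repr z) = z.
Proof. by rewrite /to_iquo reprK. Qed.

Lemma iquoW (K : iquo -> Prop) : (forall x, K (to_iquo x)) -> forall z, K z.
Proof. by move=> Kx z; rewrite -(iquo_repr z). Qed.

Definition iquo_add (z w : iquo) := to_iquo (repr z + repr w).
Definition iquo_scale (a : R) (z : iquo) := to_iquo (a *: repr z).
Definition iquo_opp (z : iquo) := iquo_scale (-1) z.

Lemma iquo_addE x y : iquo_add (to_iquo x) (to_iquo y) = to_iquo (x + y).
Proof.
apply/iquoP; rewrite opprD addrACA.
by apply: ispanD; apply/iquoP; rewrite iquo_repr.
Qed.

Lemma iquo_scaleE a x : iquo_scale a (to_iquo x) = to_iquo (a *: x).
Proof.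
by apply/iquoP; rewrite -scalerBr; apply: ispan_scale; apply/iquoP; rewrite iquo_repr.
Qed.

Fact iquo_addA : associative iquo_add.
Proof. by elim/iquoW=> x; elim/iquoW=> y; elim/iquoW=> z; rewrite !iquo_addE addrA. Qed.
Fact iquo_addC : commutative iquo_add.
Proof. by elim/iquoW=> x; elim/iquoW=> y; rewrite !iquo_addE addrC. Qed.
Fact iquo_add0 : left_id (to_iquo 0) iquo_add.
Proof. by elim/iquoW=> x; rewrite !iquo_addE add0r. Qed.
Fact iquo_addN : left_inverse (to_iquo 0) iquo_opp iquo_add.
Proof. by elim/iquoW=> x; rewrite /iquo_opp iquo_scaleE iquo_addE scaleN1r addNr. Qed.

HB.instance Definition _ :=
  GRing.isZmodule.Build iquo iquo_addA iquo_addC iquo_add0 iquo_addN.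

Fact iquo_scaleA a b x : iquo_scale a (iquo_scale b x) = iquo_scale (a * b) x.
Proof. by elim/iquoW: x => x; rewrite !iquo_scaleE scalerA. Qed.
Fact iquo_scale1 : left_id 1 iquo_scale.
Proof. by elim/iquoW=> x; rewrite iquo_scaleE scale1r. Qed.
Fact iquo_scaleDr : right_distributive iquo_scale +%R.
Proof.
move=> a; elim/iquoW=> x; elim/iquoW=> y; rewrite -[_ + _]/(iquo_add _ _).
by rewrite -[RHS]/(iquo_add _ _) !(iquo_scaleE, iquo_addE) scalerDr.
Qed.
Fact iquo_scaleDl x : {morph iquo_scale^~ x : a b / a + b}.
Proof.
move=> a b; elim/iquoW: x => x; rewrite -[RHS]/(iquo_add _ _).
by rewrite !(iquo_scaleE, iquo_addE) scalerDl.
Qed.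

HB.instance Definition _ := GRing.Zmodule_isLmodule.Build R iquo
  iquo_scaleA iquo_scale1 iquo_scaleDr iquo_scaleDl.

Fact to_iquo_is_linear : linear to_iquo.
Proof.
move=> a x y; rewrite -[RHS]/(iquo_add (iquo_scale a _) _).
by rewrite iquo_scaleE iquo_addE.
Qed.
HB.instance Definition _ := GRing.isLinear.Build R M iquo _ to_iquo to_iquo_is_linear.

Lemma iquo_eq0 x : to_iquo x = 0 <-> ispan X x.
Proof.
rewrite -(linear0 to_iquo); split=> [/iquoP|Xx]; first by rewrite subr0.
by apply/iquoP; rewrite subr0.
Qed.

End QuotientModule.

Section TensorQuotient.
Variables (R : comPzRingType) (I : set R) (idI : is_ideal I) (M : lmodType R).
Local Notation RI := (iquo I R^o).

Lemma ispan_regular (x : R^o) : ispan I x -> I x.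
Proof.
case: idI => I0 ID IM; elim=> // a m z Ia _ Iz; apply: ID => //.
by rewrite [_ *: _]mulrC; apply: IM.
Qed.

(** It induces the map from M (x) R/I to M/IM; by [tens_iquoE] the chosen representative does not
    matter. *)
Definition tens_iquo (m : M) (z : RI) : iquo I M := to_iquo I ((repr z : R) *: m).

Lemma tens_iquoE m (a : R^o) : tens_iquo m (to_iquo I a) = to_iquo I (a *: m).
Proof.
apply/iquoP; rewrite -scalerBl; apply/ispanZ/ispan_regular/iquoP.
by rewrite iquo_repr.
Qed.

Lemma tens_iquo_balanced : balanced tens_iquo.
Proof.
split=> [m m' z|m z z'|a m z]; elim/iquoW: z => z.
- by rewrite !tens_iquoE scalerDr linearD.
- by elim/iquoW: z' => z'; rewrite -linearD !tens_iquoE scalerDl linearD.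
- by rewrite -linearZ !tens_iquoE scalerA mulrC.
Qed.

Lemma tens_iquo_eq0 (m : M) : tens m (to_iquo I (1 : R^o)) = 0 -> ispan I m.
Proof.
move=> m0; have := tens_lift_tens tens_iquo_balanced m (to_iquo I (1 : R^o)).
rewrite m0 tens_lift0; last exact: tens_iquo_balanced.
by rewrite tens_iquoE scale1r => /esym/iquo_eq0.
Qed.

Lemma tens_iquol_eq0 (m : M) : tens (to_iquo I (1 : R^o)) m = 0 -> ispan I m.
Proof.
have bal : balanced (fun z m => tens_iquo m z).
  have [bl br bz] := tens_iquo_balanced.
  by split=> *; [exact: br|exact: bl|rewrite bz].
move=> m0; have := tens_lift_tens bal (to_iquo I (1 : R^o)) m.
rewrite m0 tens_lift0 // tens_iquoE scale1r => /esym/iquo_eq0 //.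
Qed.

Lemma tens_iquo_ispan (m : M) : ispan I m -> tens m (to_iquo I (1 : R^o)) = 0.
Proof.
elim=> [|a x z Ia _ IH].
  by rewrite -(scale0r (0 : M)) tensZl scale0r.
rewrite tensDl IH addr0 tensZl -tensZr -linearZ /=.
have -> : to_iquo I (a *: (1 : R^o)) = 0.
  by apply/iquo_eq0/ispanZ.
by rewrite -(scale0r (0 : RI)) tensZr scale0r.
Qed.

Lemma tens_iquol_ispan (m : M) : ispan I m -> tens (to_iquo I (1 : R^o)) m = 0.
Proof.
elim=> [|a x z Ia _ IH].
  by rewrite -(scale0r (0 : M)) tensZr scale0r.
rewrite tensDr IH addr0 tensZr -tensZl -linearZ /=.
have -> : to_iquo I (a *: (1 : R^o)) = 0.
  by apply/iquo_eq0/ispanZ.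
by rewrite -(scale0r (0 : RI)) tensZl scale0r.
Qed.

End TensorQuotient.

(** * Colon ideals as a test for flatness *)

Section Colon.
Variable R : comPzRingType.

(** The substantial inclusion in (IW : x) = (I : x) W. It is equivalent to flatness
    ([flat_has_colon], [colon_flat]) and mentions only ideals and elements, the form that noetherian
    induction and Artin-Rees can handle. *)
Definition has_colon (W : lmodType R) : Prop :=
  forall I x, is_ideal I -> forall w : W, ispan I (x *: w) -> ispan (colon I x) w.

(** Triviality of the kernel of M/IM -> N/IN, stated on representatives. *)
Definition inj_mod (M N : lmodType R) (h : M -> N) (I : set R) : Prop :=
  forall m, ispan I (h m) -> ispan I m.

Lemma pure_inj_mod (M N : lmodType R) (h : {linear M -> N}) I :
  pure_linear h -> is_ideal I -> inj_mod h I.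
Proof.
move=> pure_h idI m /tens_iquol_ispan hm0.
apply: tens_iquol_eq0 => //; apply: pure_h.
by rewrite tens_mapE hm0 /tens_map tens_lift0 //; exact: tens_map_balanced.
Qed.

Section FlatColon.
Variables (I : set R) (x : R) (idI : is_ideal I).
Local Notation J := (colon I x).

(** Multiplication by x, from R/(I : x) to R/I. The proof that I is an ideal is an argument so that
    the linearity instance can recover it from the term. *)
Definition colon_map of is_ideal I := fun z : iquo J R^o => to_iquo I (x *: repr z).

Lemma colon_mapE (a : R^o) : colon_map idI (to_iquo J a) = to_iquo I (x *: a).
Proof.
apply/iquoP; rewrite -scalerBr.
have /iquoP/ispan_regular := iquo_repr (to_iquo J a).
move/(_ (colon_is_ideal x idI)); rewrite /colon /= mulrC => Ia.
by rewrite -[_ *: _]addr0 -[X in X + _]mulr1; apply: ispan_cons Ia (ispan0 _ _).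
Qed.

Fact colon_map_is_linear : linear (colon_map idI).
Proof.
move=> a; elim/iquoW=> y; elim/iquoW=> z; rewrite -linearP !colon_mapE.
by rewrite -linearP; congr to_iquo; rewrite scalerDr !scalerA mulrC.
Qed.
HB.instance Definition _ := GRing.isLinear.Build R _ _ _ (colon_map idI) colon_map_is_linear.

Lemma colon_map_inj : injective (colon_map idI).
Proof.
elim/iquoW=> y; elim/iquoW=> z; rewrite !colon_mapE => /iquoP.
rewrite -scalerBr => /(ispan_regular idI) Iyz; apply/iquoP.
rewrite -[y - z]mulr1; apply: ispanZ.
by rewrite /colon /= mulrC.
Qed.

End FlatColon.

(** Multiplication by x embeds R/(I : x) into R/I; flatness keeps this injective after tensoring
    with W. *)
Lemma flat_has_colon (W : lmodType R) : flat_module W -> has_colon W.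
Proof.
move=> flatW I x idI w Iw.
apply: tens_iquo_eq0; first exact: colon_is_ideal.
pose h : {linear iquo (colon I x) R^o -> iquo I R^o} := colon_map idI.
apply: (flatW _ _ h (@colon_map_inj _ _ idI)).
rewrite tens_mapE /tens_map tens_lift0; last exact: tens_map_balanced.
rewrite /h /= colon_mapE linearZ tensZr -tensZl.
exact: tens_iquo_ispan.
Qed.

End Colon.

Lemma ispan_gen (R : comPzRingType) (M : lmodType R) n (g : 'I_n -> R) (m : 'I_n -> M) :
  ispan (gen_ideal g) (\sum_i g i *: m i).
Proof. by apply: ispan_sum => i; apply/ispanZ/gen_ideal_mem. Qed.

Lemma ispanP (R : comPzRingType) (X : set R) (M : lmodType R) (x : M) : ispan X x ->
  exists n (a : 'I_n -> R) (m : 'I_n -> M), (forall i, X (a i)) /\ x = \sum_i a i *: m i.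
Proof.
elim=> [|a m z Xa _ [n [b [m' [Xb ->]]]]].
  by exists 0%N, (fun=> 0), (fun=> 0); split=> [[]//|]; rewrite big_ord0.
exists n.+1, (fun i => oapp b a (unlift ord0 i)), (fun i => oapp m' m (unlift ord0 i)).
split=> [i|]; first by case: (unlift ord0 i) => [j|] /=.
rewrite big_ord_recl unlift_none /=; congr (_ + _); apply: eq_bigr => i _.
by rewrite liftK.
Qed.

Lemma gen_ideal_is_ideal (R : comPzRingType) n (g : 'I_n -> R) : is_ideal (gen_ideal g).
Proof.
split=> [|_ _ [c ->] [d ->]|a _ [c ->]].
- by exists (fun=> 0); rewrite big1 // => i _; rewrite mul0r.
- by exists (fun i => c i + d i); rewrite -big_split; apply: eq_bigr => i _; rewrite mulrDl.
- by exists (fun i => a * c i); rewrite mulr_sumr; apply: eq_bigr => i _; rewrite mulrA.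
Qed.

(** * The equational criterion: relations in a flat module and vanishing of tensors *)

Section Equational.
Variables (R : comPzRingType) (W : lmodType R) (colonW : has_colon W).

(** Induction on the length: with a' the remaining coefficients, a_0 w_0 lies in (a') W, so the
    colon hypothesis writes w_0 as a combination of some v_j with coefficients rho_j in ((a') :
    a_0). *)
Lemma flat_relation n (a : 'I_n -> R) (w : 'I_n -> W) : \sum_i a i *: w i = 0 ->
  exists m (v : 'I_m -> W) (r : 'I_n -> 'I_m -> R),
    (forall i, w i = \sum_k r i k *: v k) /\ forall k, \sum_i a i * r i k = 0.
Proof.
elim: n a w => [|n IHn] a w.
  by exists 0%N, (fun=> 0), (fun _ _ => 0); split=> [[]//|[]//].
rewrite big_ord_recl => aw0.
pose a' i := a (lift ord0 i); pose w' i := w (lift ord0 i).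
have Iw : ispan (gen_ideal a') (a ord0 *: w ord0).
  have -> : a ord0 *: w ord0 = \sum_i a' i *: - w' i.
    apply/eqP; rewrite -subr_eq0 -sumrN -[X in _ == X]aw0; apply/eqP; congr (_ + _).
    by apply: eq_bigr => i _; rewrite scalerN opprK.
  exact: ispan_gen.
have [m [rho [v [rhoP w0E]]]] := ispanP (colonW (gen_ideal_is_ideal a') Iw).
have /choice[c cP] : forall j, exists c : 'I_n -> R, rho j * a ord0 = \sum_i c i * a' i.
  by move=> j; apply: rhoP.
(* Substituting the expression of rho_j a_0 in the a'_i absorbs the first term into the others and
   leaves a relation of length n. *)
have [|m' [v' [r [w'E rP]]]] := IHn a' (fun i => w' i + \sum_j c j i *: v j).
  rewrite -[RHS]aw0 w0E scaler_sumr addrC.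
  transitivity (\sum_(i < n) a' i *: w' i + \sum_j (rho j * a ord0) *: v j).
    rewrite (eq_bigr _ (fun i _ => scalerDr _ _ _)) big_split /=; congr (_ + _).
    rewrite (eq_bigr _ (fun i _ => scaler_sumr _ _ _ _)) exchange_big /=.
    apply: eq_bigr => j _; rewrite cP scaler_suml; apply: eq_bigr => i _.
    by rewrite scalerA mulrC.
  by congr (_ + _); apply: eq_bigr => j _; rewrite scalerA mulrC.
exists (m + m')%N, (fun k => match split k with inl j => v j | inr j => v' j end).
exists (fun i k => match unlift ord0 i, split k with
  | None, inl j => rho j | None, inr _ => 0
  | Some i', inl j => - c j i' | Some i', inr j => r i' j end).
split=> [i|k].
  rewrite big_split_ord /=.
  case: unliftP => [i' ->|->].
    rewrite -[LHS](addrK (\sum_j c j i' *: v j)) [X in X - _ = _]w'E addrC -sumrN.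
    by congr (_ + _); apply: eq_bigr => j _;
      rewrite ?(unsplitK (inl j)) ?(unsplitK (inr j)) //= scaleNr.
  rewrite [X in _ + X]big1 => [|j _]; last by rewrite (unsplitK (inr j)) /= scale0r.
  by rewrite addr0 w0E; apply: eq_bigr => j _; rewrite (unsplitK (inl j)).
rewrite big_ord_recl unlift_none.
under eq_bigr do rewrite liftK.
case: splitP => j _.
  rewrite mulrC cP; apply/eqP; rewrite addr_eq0 -sumrN; apply/eqP.
  by apply: eq_bigr => i _; rewrite mulrN opprK mulrC.
by rewrite mulr0 add0r; exact: rP.
Qed.

Variable M : lmodType R.

(* [rep v s y]: expressing the first components of s in terms of v formally
   turns the word s into \sum_k v k (x) y k. Words with y = 0 represent the
   zero tensor; for flat W the converse holds ([null_wordP]), and the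
   existence of such an expression is reflected by injective maps on M. *)
Fixpoint rep m (v : 'I_m -> W) (s : seq (W * M)) (y : 'I_m -> M) : Prop :=
  match s with
  | [::] => forall k, y k = 0
  | u :: s' => exists2 r : 'I_m -> R, u.1 = \sum_k r k *: v k &
                rep v s' (fun k => y k - r k *: u.2)
  end.

Definition null_word s := exists m (v : 'I_m -> W), rep v s (fun=> 0).

Lemma rep_cat m (v : 'I_m -> W) s t y :
  rep v (s ++ t) y <-> exists2 z, rep v s z & rep v t (fun k => y k - z k).
Proof.
elim: s y => [|u s IHs] y /=.
  split=> [tv|[z z0]]; first by exists (fun=> 0) => //; under eq_fun do rewrite subr0.
  by rewrite (_ : (fun k => y k - z k) = y) //; apply/funext => k; rewrite z0 subr0.
split=> [[r u1 /IHs[z sz tz]]|[z [r u1 sz] tz]].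
  exists (fun k => z k + r k *: u.2).
    by exists r => //; under eq_fun do rewrite addrK.
  by move: tz; congr (rep v t _); apply/funext => k; rewrite opprD addrA addrAC.
exists r => //; apply/IHs; exists (fun k => z k - r k *: u.2) => //.
move: tz; congr (rep v t _); apply/funext => k.
by rewrite opprB addrA subrK.
Qed.

Lemma rep_refine m (v : 'I_m -> W) m' (v' : 'I_m' -> W) (rho : 'I_m -> 'I_m' -> R) s y :
  (forall k, v k = \sum_l rho k l *: v' l) -> rep v s y ->
  rep v' s (fun l => \sum_k rho k l *: y k).
Proof.
move=> vE; elim: s y => [|u s IHs] y /=.
  by move=> y0 l; rewrite big1 // => k _; rewrite y0 scaler0.
move=> [r u1 sy]; exists (fun l => \sum_k r k * rho k l).
  rewrite u1; under eq_bigr do rewrite vE scaler_sumr.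
  rewrite exchange_big; apply: eq_bigr => l _; rewrite scaler_suml.
  by apply: eq_bigr => k _; rewrite scalerA.
move: (IHs _ sy); congr (rep v' s _); apply/funext => l.
rewrite scaler_suml -sumrB; apply: eq_bigr => k _.
by rewrite scalerBr scalerA mulrC.
Qed.

Lemma rep_extend m (v : 'I_m -> W) (x : W) s y :
  rep v s y ->
  rep (fun k => oapp v x (unlift ord0 k)) s (fun k => oapp y 0 (unlift ord0 k)).
Proof.
move=> sv; have := @rep_refine m v m.+1 (fun k => oapp v x (unlift ord0 k))
  (fun k l => (l == lift ord0 k)%:R) s y _ sv.
have -> : (fun l : 'I_m.+1 => \sum_k (l == lift ord0 k)%:R *: y k)
          = fun k => oapp y 0 (unlift ord0 k).
  apply/funext => l; case: unliftP => [k ->|->] /=.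
    rewrite (bigD1 k) //= eqxx scale1r big1 ?addr0 // => j jk.
    by rewrite (inj_eq lift_inj) eq_sym (negPf jk) scale0r.
  by rewrite big1 // => k _; rewrite scale0r.
apply=> k; rewrite (bigD1 (lift ord0 k)) //= eqxx scale1r liftK /= big1 ?addr0 //.
by move=> l /negPf->; rewrite scale0r.
Qed.

Lemma sum_extend (V : lmodType R) m (v : 'I_m -> V) (x : V) (r : 'I_m -> R) (c : R) :
  \sum_(k < m.+1) oapp r c (unlift ord0 k) *: oapp v x (unlift ord0 k) =
  c *: x + \sum_k r k *: v k.
Proof.
rewrite big_ord_recl unlift_none; congr (_ + _).
by apply: eq_bigr => k _; rewrite liftK.
Qed.

(** The difference of the two expressions is a relation among the v_k; after refining v to v' as in
    [flat_relation], it holds already between the coefficients. *)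
Lemma two_reps m (v : 'I_m -> W) (r r' : 'I_m -> R) :
  \sum_k r k *: v k = \sum_k r' k *: v k ->
  exists m' (v' : 'I_m' -> W) (rho : 'I_m -> 'I_m' -> R),
    (forall k, v k = \sum_l rho k l *: v' l) /\
    forall l, \sum_k r k * rho k l = \sum_k r' k * rho k l.
Proof.
move=> e; have [|m' [v' [rho [vE rhoE]]]] := @flat_relation m (fun k => r k - r' k) v.
  under eq_bigr do rewrite scalerBl.
  by rewrite sumrB e subrr.
exists m', v', rho; split=> // l; apply/eqP; rewrite -subr_eq0 -sumrB -[X in _ == X](rhoE l).
by apply/eqP; apply: eq_bigr => k _; rewrite mulrBl.
Qed.

(** The trailing word [u] makes the claim stable under [TensCat]. Flatness enters only at [TensAddr]
    and [TensBal], where two expressions of the same element have to be reconciled by [two_reps]. *)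
Lemma null_word_rel s t : tens_rel s t ->
  forall u, null_word (s ++ u) <-> null_word (t ++ u).
Proof.
have swap s1 s2 u : null_word (s1 ++ s2 ++ u) -> null_word (s2 ++ s1 ++ u).
  move=> [m [v /rep_cat[z1 r1 /rep_cat[z2 r2 ru]]]]; exists m, v.
  apply/rep_cat; exists z2 => //; apply/rep_cat; exists z1 => //.
  by move: ru; congr (rep v u _); apply/funext => k; rewrite addrAC.
elim=> {s t}.
- by [].
- by move=> s t _ st u; rewrite st.
- by move=> s t u _ st _ tu w; rewrite st tu.
- move=> s s' t t' _ ss' _ tt' u; rewrite -!catA ss'.
  by split=> /swap h; apply: (swap); [rewrite -tt'|rewrite tt'].
- by move=> s t u; rewrite -!catA; split; exact: swap.
- move=> u /=; split=> -[m [v h]]; exists m, v.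
    by case: h => r _; congr (rep v u _); apply/funext => k; rewrite scaler0 subr0.
  exists (fun=> 0); first by rewrite big1 // => k _; rewrite scale0r.
  by move: h; congr (rep v u _); apply/funext => k; rewrite scaler0 subr0.
- move=> x x' y u /=; split=> -[m [v]].
    (* Only x + x' is expressed so far. Adjoining x' as a new entry of v expresses x' by itself, and
       x with coefficient -1 on that entry. *)
    move=> [r /= xE ru]; exists m.+1, (fun k => oapp v x' (unlift ord0 k)).
    exists (fun k => oapp r (-1) (unlift ord0 k)).
      by rewrite sum_extend -xE addrC scaleN1r addrK.
    exists (fun k => oapp (fun=> 0) 1 (unlift ord0 k)).
      by rewrite sum_extend scale1r big1 ?addr0 // => k _; rewrite scale0r.
    move: (rep_extend x' ru); congr (rep _ u _); apply/funext => k.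
    by case: (unlift ord0 k) => [j|] /=; rewrite ?(scale0r, subr0) //
      ?(scaleN1r, scale1r, sub0r, opprK, subrr).
  move=> [r /= xE [r' /= xE' ru]]; exists m, v, (fun k => r k + r' k).
    by rewrite /= xE xE' -big_split; apply: eq_bigr => k _; rewrite scalerDl.
  by move: ru; congr (rep v u _); apply/funext => k; rewrite scalerDl opprD addrA.
- move=> x y y' u /=; split=> -[m [v]].
    move=> [r /= xE ru]; exists m, v, r => //; exists r => //.
    by move: ru; congr (rep v u _); apply/funext => k; rewrite scalerDr opprD addrA.
  move=> [r /= xE [r' /= xE' ru]].
  have [|m' [v' [rho [vE rhoE]]]] := @two_reps m v r r'; first by rewrite -xE -xE'.
  exists m', v', (fun l => \sum_k r k * rho k l).
    rewrite /= xE; under eq_bigr do rewrite vE scaler_sumr.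
    rewrite exchange_big; apply: eq_bigr => l _; rewrite scaler_suml.
    by apply: eq_bigr => k _; rewrite scalerA.
  move: (rep_refine vE ru); congr (rep v' u _); apply/funext => l /=.
  rewrite sub0r scalerDr {2}rhoE !scaler_suml -big_split -sumrN.
  apply: eq_bigr => k _ /=; rewrite sub0r -opprD scalerN scalerDr !scalerA.
  by rewrite !(mulrC (rho k l)).
- move=> a x y u /=; split=> -[m [v]].
    (* After adjoining x, the element a x has two expressions: the old one, and a times the new
       entry. *)
    move=> [r /= xE ru]; pose v1 (k : 'I_m.+1) := oapp v x (unlift ord0 k).
    have [|m' [v' [rho [vE rhoE]]]] := @two_reps _ v1
        (fun k => oapp r 0 (unlift ord0 k)) (fun k => oapp (fun=> 0) a (unlift ord0 k)).
      rewrite !sum_extend scale0r add0r -xE big1 ?addr0 // => k _.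
      by rewrite scale0r.
    exists m', v', (rho ord0).
      by have /= := vE ord0; rewrite /v1 unlift_none.
    move: (rep_refine vE (rep_extend x ru)); congr (rep v' u _); apply/funext => l /=.
    have {rhoE} := rhoE l.
    rewrite !big_ord_recl !unlift_none /= mul0r add0r scaler0 add0r.
    under eq_bigr do rewrite liftK /=.
    under [in RHS]eq_bigr do rewrite liftK /= mul0r.
    rewrite big1_eq addr0 => rhoE.
    rewrite sub0r scalerA [rho ord0 l * a]mulrC -rhoE scaler_suml -sumrN.
    apply: eq_bigr => k _; rewrite liftK /= sub0r scalerN scalerA.
    by rewrite mulrC.
  move=> [r /= xE ru]; exists m, v, (fun k => a * r k).
    by rewrite /= xE scaler_sumr; apply: eq_bigr => k _; rewrite scalerA.
  by move: ru; congr (rep v u _); apply/funext => k; rewrite scalerA mulrC.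
Qed.

Lemma null_wordP s : tens_cls s = 0 -> null_word s.
Proof.
rewrite -tens_cls0 => /tens_clsP/null_word_rel/(_ [::]); rewrite cats0 => ->.
by exists 0%N, (fun=> 0).
Qed.

Lemma rep_tens m (v : 'I_m -> W) s y : rep v s y ->
  tens_cls s = \sum_k tens (v k) (y k).
Proof.
elim: s y => [|[w x] s IHs] y /=.
  move=> y0; rewrite big1 // => k _; rewrite y0.
  by rewrite -(scale0r (0 : M)) tensZr scale0r.
move=> [r /= -> /IHs sE]; rewrite -cat1s tens_clsD sE.
have -> : tens_cls [:: (\sum_k r k *: v k, x)] = \sum_k tens (v k) (r k *: x).
  rewrite -[LHS]/(tens _ _).
  elim/big_rec2: _ => [|k z t _ IH].
    by rewrite -(scale0r (0 : W)) tensZl scale0r.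
  by rewrite tensDl IH tensZl -tensZr.
by rewrite -big_split /=; apply: eq_bigr => k _; rewrite -tensDr addrC subrK.
Qed.

End Equational.

(** An expression witnessing that the image of a tensor vanishes has its coefficients in R and its
    v_k in W, so it applies verbatim to the tensor itself; injectivity of h is needed only for the
    final equations y k = 0. *)
Lemma colon_flat (R : comPzRingType) (W : lmodType R) : has_colon W -> flat_module W.
Proof.
move=> colonW M M' h inj_h.
have addh z w : tens_map (W := W) h (z + w) = tens_map h z + tens_map h w.
  exact/tens_liftD/tens_map_balanced.
have ker z : tens_map (W := W) h z = 0 -> z = 0.
  elim/tens_cls_ind: z => s hs0.
  have /(null_wordP colonW)[m [v]] : tens_cls [seq (u.1, h u.2) | u <- s] = 0 :> tensor W M'.
    by rewrite -hs0 /tens_map tens_lift_cls ?tens_cls_sum ?big_map //; exact: tens_map_balanced.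
  have {hs0} : (fun=> 0 : M') = h \o (fun=> 0 : M) :> ('I_m -> M').
    by apply/funext => k /=; rewrite linear0.
  move=> -> hrep.
  suff /rep_tens -> : rep v s (fun=> 0).
    by rewrite big1 // => k _; rewrite -(scale0r (0 : M)) tensZr scale0r.
  elim: s {addh} (fun=> 0 : M) hrep => [|u s IHs] y /=.
    by move=> hy k; apply: inj_h; rewrite linear0 [h _]hy.
  move=> [r uE hs]; exists r => //; apply: IHs; move: hs.
  congr (rep v _ _); apply/funext => k /=.
  by rewrite linearB [h (_ *: _)]linearZ.
move=> z w zw; apply/eqP; rewrite -subr_eq0; apply/eqP/ker.
have hN : tens_map (W := W) h (- w) = - tens_map h w.
  apply: (addrI (tens_map h w)); rewrite -addh !subrr.
  exact/tens_lift0/tens_map_balanced.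
by rewrite addh hN zw subrr.
Qed.

Section TensMap.
Variables (R : comPzRingType) (W M N : lmodType R) (h : {linear M -> N}).

Lemma tens_mapD (z w : tensor W M) : tens_map h (z + w) = tens_map h z + tens_map h w.
Proof. exact/tens_liftD/tens_map_balanced. Qed.

Lemma tens_map0 : tens_map h (0 : tensor W M) = 0.
Proof. exact/tens_lift0/tens_map_balanced. Qed.

Lemma tens_map_sub (z w : tensor W M) : tens_map h (z - w) = tens_map h z - tens_map h w.
Proof. by apply: (canRL (addrK _)); rewrite -tens_mapD subrK. Qed.

Lemma tens_map_inj : (forall z : tensor W M, tens_map h z = 0 -> z = 0) ->
  injective (tens_map (W := W) h).
Proof.
move=> ker z w zw; apply/eqP; rewrite -subr_eq0; apply/eqP/ker.
by rewrite tens_map_sub zw subrr.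
Qed.

End TensMap.

Lemma bijective_pure (R : comPzRingType) (M N : lmodType R) (h : {linear M -> N}) :
  bijective h -> pure_linear h.
Proof.
case=> g hK gK W.
have bal : balanced (fun (w : W) y => tens w (g y)).
  split=> [w w' x|w x x'|a w x]; first exact: tensDl.
    by rewrite -tensDr; congr tens; apply: (can_inj hK); rewrite linearD !gK.
  by rewrite tensZl -tensZr; congr tens; apply: (can_inj hK); rewrite linearZ !gK.
apply: (can_inj (g := tens_lift (fun w y => tens w (g y)))).
elim/tensor_ind=> [|w x|z w zE wE].
- by rewrite tens_map0 tens_lift0.
- by rewrite tens_mapE tens_lift_tens // hK.
- by rewrite tens_mapD tens_liftD // zE wE.
Qed.

(** * Change of rings for flatness and purity *)

Section RestrictScalars.
Variables (R T : comPzRingType) (g : {rmorphism R -> T}) (M : lmodType T).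

(** The phantom argument keeps in the type the ring map on which the R-module structure depends. *)
Definition restr (_ : {rmorphism R -> T}) : Type := M.
HB.instance Definition _ := GRing.Zmodule.on (restr g).

Definition restr_scale (a : R) (x : restr g) : restr g := g a *: (x : M).

Fact restr_scaleA a b x : restr_scale a (restr_scale b x) = restr_scale (a * b) x.
Proof. by rewrite /restr_scale scalerA rmorphM. Qed.
Fact restr_scale1 : left_id 1 restr_scale.
Proof. by move=> x; rewrite /restr_scale rmorph1 scale1r. Qed.
Fact restr_scaleDr : right_distributive restr_scale +%R.
Proof. by move=> a x y; rewrite /restr_scale scalerDr. Qed.
Fact restr_scaleDl x : {morph restr_scale^~ x : a b / a + b}.
Proof. by move=> a b; rewrite /restr_scale rmorphD scalerDl. Qed.

HB.instance Definition _ := GRing.Zmodule_isLmodule.Build R (restr g)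
  restr_scaleA restr_scale1 restr_scaleDr restr_scaleDl.

End RestrictScalars.

Section RestrictMap.
Variables (R T : comPzRingType) (g : {rmorphism R -> T}) (M N : lmodType T).
Variable h : {linear M -> N}.

Definition restr_map : restr M g -> restr N g := h.

Fact restr_map_is_linear : linear restr_map.
Proof. by move=> a x y; rewrite /restr_map linearP. Qed.
HB.instance Definition _ := GRing.isLinear.Build R (restr M g) (restr N g) _
  restr_map restr_map_is_linear.

End RestrictMap.

Section BaseChange.
Variables (R S T : comPzRingType) (f : {rmorphism R -> S}) (g : {rmorphism R -> T}).
Local Notation U := (alg_of (tens_inr f g)).

Lemma tens_inrZ (a : T) (s : S) (t : T) :
  a *: (tens_r f g s t : U) = tens_r f g s (a * t).
Proof.
by rewrite alg_ofZ -[RHS](mul1r) -[LHS]/(tens_r f g 1 a * tens_r f g s t) tens_rM mul1r mul1r.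
Qed.

Section Assoc.
Variable M : lmodType T.

Definition assoc1 (m : M) : tensor_ring f g -> tensor (alg_of f) (restr M g) :=
  tens_lift (fun (s : alg_of f) (t : alg_of g) =>
     tens s ((t : T) *: m : restr M g)).

Lemma assoc1_balanced m : balanced (fun (s : alg_of f) (t : alg_of g) =>
     tens s ((t : T) *: m : restr M g)).
Proof.
split=> [s s' t|s t t'|a s t]; first by rewrite tensDl.
  by rewrite -tensDr scalerDl.
by rewrite tensZl -tensZr; congr tens; rewrite [LHS]scalerA.
Qed.

Lemma assoc1E m s t :
  assoc1 m (tens_r f g s t) = tens (s : alg_of f) (t *: m : restr M g).
Proof. by rewrite [LHS]tens_lift_tens //; exact: assoc1_balanced. Qed.

Lemma assoc1D m z w : assoc1 m (z + w) = assoc1 m z + assoc1 m w.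
Proof. exact/tens_liftD/assoc1_balanced. Qed.

Lemma assoc10 m : assoc1 m 0 = 0.
Proof. exact/tens_lift0/assoc1_balanced. Qed.

Definition assoc : tensor U M -> tensor (alg_of f) (restr M g) :=
  tens_lift (fun (x : U) m => assoc1 m x).

Lemma assoc_balanced : balanced (fun (x : U) m => assoc1 m x).
Proof.
split=> [x y m|x m m'|a x m]; first exact: assoc1D.
- elim/tensor_ring_ind: x => [|s t|z w zE wE]; first by rewrite !assoc10 addr0.
    by rewrite !assoc1E scalerDr -tensDr.
  by rewrite !assoc1D zE wE addrACA.
- elim/tensor_ring_ind: x => [|s t|z w zE wE]; first by rewrite scaler0 !assoc10.
    by rewrite tens_inrZ !assoc1E scalerA mulrC.
  by rewrite scalerDr !assoc1D zE wE.
Qed.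

Lemma assocE (x : U) m : assoc (tens x m) = assoc1 m x.
Proof. by rewrite [LHS]tens_lift_tens //; exact: assoc_balanced. Qed.

Lemma assocD z w : assoc (z + w) = assoc z + assoc w.
Proof. exact/tens_liftD/assoc_balanced. Qed.

Lemma assoc0 : assoc 0 = 0.
Proof. exact/tens_lift0/assoc_balanced. Qed.

Definition unassoc : tensor (alg_of f) (restr M g) -> tensor U M :=
  tens_lift (fun (s : alg_of f) (m : restr M g) => tens (tens_r f g s 1 : U) (m : M)).

Lemma unassoc_balanced : balanced (fun (s : alg_of f) (m : restr M g) =>
  tens (tens_r f g s 1 : U) (m : M)).
Proof.
split=> [s s' m|s m m'|a s m].
- by rewrite tens_rDl tensDl.
- by rewrite tensDr.
- transitivity (tens (g a *: (tens_r f g s 1 : U)) m); last by rewrite tensZl -tensZr.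
  by congr tens; rewrite tens_inrZ -tens_r_bal.
Qed.

Lemma assocK : cancel assoc unassoc.
Proof.
have u0 : unassoc 0 = 0 by exact/tens_lift0/unassoc_balanced.
have uD z w : unassoc (z + w) = unassoc z + unassoc w.
  exact/tens_liftD/unassoc_balanced.
elim/tensor_ind=> [|x m|z w zE wE]; last by rewrite assocD uD zE wE.
  by rewrite assoc0 u0.
rewrite assocE; elim/tensor_ring_ind: x => [|s t|z w zE wE].
- by rewrite assoc10 u0 -(scale0r (0 : U)) tensZl scale0r.
- rewrite assoc1E [LHS]tens_lift_tens; last exact: unassoc_balanced.
  by rewrite tensZr -tensZl tens_inrZ mulr1.
- by rewrite assoc1D uD zE wE -tensDl.
Qed.

End Assoc.

(** The isomorphism of (S (x)_R T) (x)_T M with S (x)_R M is natural in M, so tensoring over T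
    amounts to tensoring the restriction to R with S. *)
Lemma base_change_flat : flat_rmorphism f -> flat_rmorphism (tens_inr f g).
Proof.
move=> flatf M N h inj_h.
pose h' : {linear restr M g -> restr N g} := @restr_map _ _ g _ _ h.
have nat z : assoc (tens_map (W := U) h z) =
    tens_map (W := alg_of f) h' (assoc z).
  elim/tensor_ind: z => [|x m|z w zE wE].
  - by rewrite tens_map0 !assoc0 tens_map0.
  - rewrite tens_mapE !assocE; elim/tensor_ring_ind: x => [|s t|z w zE wE].
    + by rewrite !assoc10 tens_map0.
    + by rewrite !assoc1E tens_mapE /h' /= /restr_map linearZ.
    + by rewrite !assoc1D zE wE tens_mapD.
  - by rewrite tens_mapD !assocD zE wE tens_mapD.
move=> z w zw; apply: (can_inj (@assocK M)).
apply: (flatf _ _ h') => //.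
by rewrite -!nat zw.
Qed.

End BaseChange.

Section ExtendScalars.
Variables (R S : comPzRingType) (i : {rmorphism R -> S}) (W : lmodType R).

Definition ext : Type := tensor W (alg_of i).
Local Notation E := ext.
HB.instance Definition _ := GRing.Zmodule.on E.

Definition ext_scale (s : S) : E -> E :=
  tens_lift (fun (w : W) (x : alg_of i) => tens w ((s : alg_of i) * x)).

Lemma ext_scale_balanced s :
  balanced (fun (w : W) (x : alg_of i) => tens w ((s : alg_of i) * x)).
Proof.
split=> [w w' x|w x x'|a w x]; first exact: tensDl.
  by rewrite mulrDr tensDr.
by rewrite tensZl -tensZr; congr tens; rewrite !alg_ofZ mulrCA.
Qed.

Lemma ext_scaleE s (w : W) (x : alg_of i) :
  ext_scale s (tens w x) = tens w ((s : alg_of i) * x).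
Proof. by rewrite [LHS]tens_lift_tens //; exact: ext_scale_balanced. Qed.

Fact ext_scaleDr : right_distributive ext_scale +%R.
Proof. by move=> s z w; exact/tens_liftD/ext_scale_balanced. Qed.

Lemma ext_scale0 s : ext_scale s 0 = 0.
Proof. exact/tens_lift0/ext_scale_balanced. Qed.

Fact ext_scaleA s t z : ext_scale s (ext_scale t z) = ext_scale (s * t) z.
Proof.
elim/tensor_ind: z => [|w x|z w zE wE]; first by rewrite !ext_scale0.
  by rewrite !ext_scaleE mulrA.
by rewrite [in LHS]ext_scaleDr !ext_scaleDr zE wE.
Qed.

Fact ext_scale1 : left_id 1 ext_scale.
Proof.
elim/tensor_ind=> [|w x|z w zE wE]; first by rewrite ext_scale0.
  by rewrite ext_scaleE mul1r.
by rewrite ext_scaleDr zE wE.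
Qed.

Fact ext_scaleDl z : {morph ext_scale^~ z : a b / a + b}.
Proof.
move=> a b /=; elim/tensor_ind: z => [|w x|z w zE wE].
- by rewrite !ext_scale0 addr0.
- by rewrite !ext_scaleE mulrDl -tensDr.
- by rewrite !ext_scaleDr zE wE addrACA.
Qed.

HB.instance Definition _ := GRing.Zmodule_isLmodule.Build S E
  ext_scaleA ext_scale1 ext_scaleDr ext_scaleDl.

Lemma extZ s (w : W) (x : S) : s *: (tens w (x : alg_of i) : E) = tens w ((s * x : S) : alg_of i).
Proof. exact: ext_scaleE. Qed.

End ExtendScalars.

(** For an R-module W, put E = W (x)_R S, an S-module. Then W (x)_R S -> W (x)_R S' becomes E (x)_S
    S -> E (x)_S S' once the target is mapped by [j], and S-purity applies to E. *)
Lemma pure_rmorphism_linear (R S S' : comPzRingType) (i : {rmorphism R -> S})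
    (i' : {rmorphism R -> S'}) (h : {rmorphism S -> S'}) (hi : h \o i =1 i') :
  pure_rmorphism h -> pure_linear (alg_linear hi).
Proof.
move=> pure_h W; apply: tens_map_inj => z hz0.
pose E : lmodType S := ext i W.
pose SS : lmodType S := alg_of (idfun : {rmorphism S -> S}).
have balj : balanced (fun (w : W) (y : alg_of i') =>
    tens (tens w (1 : alg_of i) : E) (y : alg_of h)).
  split=> [w w' y|w y y'|a w y].
  - by rewrite -tensDl -[in RHS]tensDl.
  - by rewrite tensDr.
  - have -> : tens (a *: w) (1 : alg_of i) = i a *: (tens w (1 : alg_of i) : E).
      by rewrite extZ tensZl -tensZr alg_ofZ.
    rewrite tensZl -tensZr; congr tens.
    by rewrite [RHS]alg_ofZ [LHS]alg_ofZ -hi.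
pose j := tens_lift (fun (w : W) (y : alg_of i') =>
    tens (tens w (1 : alg_of i) : E) (y : alg_of h)).
have jh t : j (tens_map (W := W) (alg_linear hi) t) = tens (t : E) (1 : alg_of h).
  elim/tensor_ind: t => [|w x|t u tE uE].
  - by rewrite tens_map0 /j tens_lift0 // -(scale0r (0 : E)) tensZl scale0r.
  - rewrite tens_mapE /j tens_lift_tens //.
    have -> : tens w x = (x : S) *: (tens w (1 : alg_of i) : E) by rewrite extZ mulr1.
    by rewrite tensZl -tensZr; congr tens; rewrite alg_ofZ mulr1.
  - by rewrite tens_mapD /j tens_liftD // -/j tE uE -tensDl.
have z1 : tens (z : E) (1 : SS) = 0.
  apply: (pure_h E); rewrite tens_mapE tens_map0 /=.
  have -> : @alg_linear S S S' idfun h h (frefl h) (1 : SS) = 1 by exact: rmorph1.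
  by rewrite -jh hz0 /j tens_lift0.
have bale : balanced (fun (e : E) (s : SS) => (s : S) *: e).
  split=> [e e' s|e s s'|a e s]; rewrite ?scalerDr ?scalerDl //.
  by rewrite scalerA mulrC.
have := tens_lift_tens bale (z : E) (1 : SS).
by rewrite z1 tens_lift0 // scale1r.
Qed.

(** * From generic injectivity and surjectivity to all ideals *)

Section NoetherianInduction.
Variables (A : comPzRingType) (noethA : noetherian A).
Variables (M N : lmodType A) (h : {linear M -> N}).

(** For prime I, flatness of M cancels the multiplier a, as (I : a) = I. Otherwise x y lies in I
    with x and y outside, and multiplication by x embeds R/(I : x) into R/I with cokernel R/(I +
    (x)): the problem for I is reduced to two strictly larger ideals. *)
Lemma inj_mod_of_generic : has_colon M -> has_colon N ->
  (forall P, is_prime P -> forall m, ispan P (h m) ->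
     exists2 a, ~ P a & ispan P (a *: m)) ->
  forall I, is_ideal I -> inj_mod h I.
Proof.
move=> colM colN gen_inj; refine (noetherian_ind noethA _) => I idI IH m hm.
have [_ ID IM] := idI.
have [prI|] := pselect (is_prime I).
  have [a nIa am] := gen_inj _ prI _ hm.
  apply: ispan_sub (colM _ _ idI _ am) => b; rewrite /colon /=.
  by case: prI => _ _ pr /pr[].
move=> /(not_prime_ideal idI)[I1|[x [y [nIx nIy Ixy]]]]; first exact: ispan1.
have /(ispan_ideal_add idI)[m' mI] : ispan (ideal_add I x) m.
  apply: (IH _ (ideal_add_is_ideal x idI) (proper_ideal_add idI nIx)).
  by apply: ispan_sub hm; exact: sub_ideal_add.
have colIx : I `<` colon I x.
  split; first by move=> a Ia; rewrite /colon /= mulrC; exact: IM.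
  by move=> /(_ y); rewrite /colon /= mulrC => /(_ Ixy).
have hm' : ispan I (x *: h m').
  rewrite -linearZ -[_ *: _](subKr m) linearB; apply: ispanB => //.
  exact: ispan_linear.
have m'I := IH _ (colon_is_ideal x idI) colIx _ (colN _ _ idI _ hm').
rewrite -(subrK (x *: m') m); apply: ispanD => //.
elim: m'I => [|a u v Ia _ IHv]; first by rewrite scaler0; exact: ispan0.
rewrite scalerDr; apply: ispanD => //; rewrite scalerA; apply: ispanZ.
by rewrite mulrC.
Qed.

(** As N is not assumed finite, the multiplier in generic surjectivity varies with n and cannot
    serve in the induction. The uniform bound on torsion supplies an a independent of n, and the
    prime case descends from I + (a). *)
Lemma surj_of_generic : (forall I, is_ideal I -> inj_mod h I) ->
  (forall P, is_prime P -> forall n : N, exists2 a, ~ P a &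
     exists m : M, ispan P (a *: n - h m)) ->
  (forall P, is_prime P -> exists2 a, ~ P a & forall n : N,
     (exists2 a', ~ P a' & ispan P (a' *: n)) -> ispan P (a *: n)) ->
  forall n : N, exists m : M, h m = n.
Proof.
move=> injh gen_surj tors.
suff surj : forall I, is_ideal I -> forall n : N, exists m : M, ispan I (n - h m).
  move=> n; have [m /ispan_eq0/eqP] := surj _ (@zero_is_ideal A) n.
  by rewrite subr_eq0 => /eqP->; exists m.
refine (noetherian_ind noethA _) => I idI IH n; have [_ ID IM] := idI.
have [prI|] := pselect (is_prime I).
  have [_ nI1 prI'] := prI.
  have [a nIa torsa] := tors _ prI.
  have [m mE] := IH _ (ideal_add_is_ideal a idI) (proper_ideal_add idI nIa) n.
  have [n1 n1E] := ispan_ideal_add idI mE.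
  (* This b depends on n1. Since h m1 is divisible by b modulo I, injectivity modulo I + (b) makes
     m1 itself so, say m1 = b m2 modulo I; then n1 - h m2 is torsion modulo I, and a kills it. *)
  have [b nIb [m1 m1E]] := gen_surj _ prI n1.
  have hm1 : ispan (ideal_add I b) (h m1).
    apply: (@ispan_add_mem _ _ _ _ _ n1 idI).
    by rewrite -opprB; exact: ispanN.
  have [m2 m2E] := ispan_ideal_add idI (injh _ (ideal_add_is_ideal b idI) _ hm1).
  have t : ispan I (a *: (n1 - h m2)).
    apply: torsa; exists b => //.
    have -> : b *: (n1 - h m2) = (b *: n1 - h m1) + h (m1 - b *: m2).
      by rewrite [h (_ - _)]linearB [h (_ *: _)]linearZ scalerBr addrA subrK.
    by apply: ispanD => //; exact: ispan_linear.
  exists (m + a *: m2).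
  have -> : n - h (m + a *: m2) = (n - h m - a *: n1) + a *: (n1 - h m2).
    by rewrite [h (_ + _)]linearD [h (_ *: _)]linearZ scalerBr addrA subrK opprD addrA.
  exact: ispanD.
move=> /(not_prime_ideal idI)[I1|[x [y [nIx nIy Ixy]]]].
  by exists 0; exact: ispan1.
have [m mE] := IH _ (ideal_add_is_ideal x idI) (proper_ideal_add idI nIx) n.
have [n1 n1E] := ispan_ideal_add idI mE.
have [m1 m1E] := IH _ (ideal_add_is_ideal y idI) (proper_ideal_add idI nIy) n1.
have [n2 n2E] := ispan_ideal_add idI m1E.
exists (m + x *: m1).
have -> : n - h (m + x *: m1) =
    (n - h m - x *: n1) + (x *: (n1 - h m1 - y *: n2) + (x * y) *: n2).
  rewrite [h (_ + _)]linearD [h (_ *: _)]linearZ -scalerA -scalerDr subrK.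
  by rewrite scalerBr addrA subrK opprD addrA.
by apply: ispanD => //; apply: ispanD; [exact: ispan_scale|exact: ispanZ].
Qed.

End NoetherianInduction.

(** * Finite algebras over a field *)

Section FiniteOverField.
Variables (k : fieldType) (C : comPzRingType) (g : {rmorphism k -> C}).

Definition spans n (c : 'I_n -> C) : Prop :=
  forall x, exists z : 'I_n -> k, x = \sum_i g (z i) * c i.

Definition indep n (c : 'I_n -> C) : Prop :=
  forall z : 'I_n -> k, \sum_i g (z i) * c i = 0 -> forall i, z i = 0.

Lemma extract_basis n (c : 'I_n -> C) : spans c ->
  exists m (s : 'I_m -> 'I_n), spans (c \o s) /\ indep (c \o s).
Proof.
elim: n c => [|n IHn] c spc; first by exists 0%N, id; split=> // z _ [].
have [ic|] := pselect (indep c); first by exists n.+1, id.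
move=> /existsNP[z /not_implyP[cz /existsNP[i /eqP zi]]].
have ciE : c i = \sum_j g (- (z i)^-1 * z (lift i j)) * c (lift i j).
  have /(congr1 (fun x => g (z i)^-1 * x)) : \sum_i g (z i) * c i = 0 := cz.
  rewrite mulr0 (bigD1_ord i) //= mulrDr mulrA -rmorphM mulVf // rmorph1 mul1r.
  move/eqP; rewrite addr_eq0 mulr_sumr -sumrN => /eqP->.
  by apply: eq_bigr => j _; rewrite mulNr rmorphN mulNr rmorphM mulrA.
have [|m [s [sps is_]]] := IHn (c \o lift i); last first.
  by exists m, (lift i \o s).
move=> x; have [y ->] := spc x.
exists (fun j => y i * (- (z i)^-1 * z (lift i j)) + y (lift i j)).
rewrite (bigD1_ord i) //= {1}ciE mulr_sumr -big_split; apply: eq_bigr => j _ /=.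
by rewrite rmorphD mulrDl mulrA -rmorphM.
Qed.

Lemma sum_mulmx m n p (A : 'M[k]_(m, n)) (B : 'M[k]_(n, p)) (c : 'I_p -> C) (d : 'I_n -> C) i :
  (forall j, d j = \sum_l g (B j l) * c l) ->
  \sum_j g (A i j) * d j = \sum_l g ((A *m B) i l) * c l.
Proof.
move=> dE; under eq_bigr do rewrite dE mulr_sumr.
rewrite exchange_big; apply: eq_bigr => l _; rewrite mxE rmorph_sum mulr_suml.
by apply: eq_bigr => j _; rewrite rmorphM mulrA.
Qed.

(** Both families have n members, so the matrix writing d in terms of c is square; a row in its
    kernel is a relation among the d_i, hence it is invertible. *)
Lemma indep_spans n (c d : 'I_n -> C) : spans c -> indep d -> spans d.
Proof.
move=> spc id_; have /choice[y yE] : forall i, exists y, d i = \sum_j g (y j) * c j.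
  by move=> i; apply: spc.
pose B : 'M[k]_n := \matrix_(i, j) y i j.
have dE i : d i = \sum_l g (B i l) * c l.
  by rewrite yE; apply: eq_bigr => j _; rewrite mxE.
have uB : B \in unitmx.
  rewrite -row_free_unit -kermx_eq0; apply/eqP/matrixP => i j; rewrite [RHS]mxE.
  apply: (id_ (kermx B i)); rewrite (sum_mulmx _ _ dE) mulmx_ker.
  by rewrite big1 // => l _; rewrite mxE rmorph0 mul0r.
have cE i : c i = \sum_j g (invmx B i j) * d j.
  rewrite (sum_mulmx _ _ dE) mulVmx // (bigD1 i) //= !mxE eqxx rmorph1 mul1r.
  rewrite big1 ?addr0 // => j ji.
  by rewrite mxE eq_sym (negPf ji) rmorph0 mul0r.
move=> x; have [z ->] := spc x.
pose Z : 'M[k]_(1, n) := \matrix_(i, j) z j.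
exists ((Z *m invmx B) ord0); rewrite -(sum_mulmx Z ord0 cE).
by apply: eq_bigr => i _; rewrite mxE.
Qed.

(** The powers 1, x, ..., x^n satisfy a nontrivial linear relation; solving for its lowest nonzero
    term gives the claim. It is the elementwise form of the descending chain condition. *)
Lemma spans_pi_regular n (c : 'I_n -> C) : spans c ->
  forall x : C, exists m (y : C), x ^+ m = x ^+ m.+1 * y.
Proof.
move=> spc x; have /choice[y yE] : forall i : 'I_n.+1, exists y, x ^+ i = \sum_j g (y j) * c j.
  by move=> i; apply: spc.
pose B : 'M[k]_(n.+1, n) := \matrix_(i, j) y i j.
have dE (i : 'I_n.+1) : x ^+ i = \sum_l g (B i l) * c l.
  by rewrite yE; apply: eq_bigr => j _; rewrite mxE.
have /rowV0Pn[v /sub_kermxP vB v0] : kermx B != 0.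
  rewrite kermx_eq0 /row_free; apply: contraTneq (rank_leq_col B) => ->.
  by rewrite ltnn.
have vx : x ^+ 0 * \sum_(i < n.+1) g (v ord0 i) * x ^+ i = 0.
  rewrite mul1r (sum_mulmx v ord0 dE) vB big1 // => l _.
  by rewrite mxE rmorph0 mul0r.
have {v0} [i0] : exists i, v ord0 i != 0.
  by apply/existsP; apply: contraNT v0; rewrite negb_exists => /forallP v0;
    apply/eqP/rowP => i; rewrite mxE; apply/eqP; rewrite -[_ == _]negbK; apply: v0.
(* The relation is generalized to one multiplied by x^e, with e = 0 at the start: a vanishing lowest
   coefficient is dropped by raising e. *)
move: (v ord0) vx i0 => {v vB yE dE B y}.
elim: (n.+1) (0%N) => [|m IHm] e v vx i0; first by case: i0.
move: vx; rewrite big_ord_recl expr0 mulr1.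
have -> : \sum_(i < m) g (v (lift ord0 i)) * x ^+ lift ord0 i =
    x * \sum_(i < m) g (v (lift ord0 i)) * x ^+ i.
  rewrite mulr_sumr; apply: eq_bigr => i _.
  by rewrite lift0 exprS mulrCA.
have [v0|v0] := eqVneq (v ord0) 0.
  rewrite v0 rmorph0 add0r mulrA -exprSr => vx vi0.
  case: (unliftP ord0 i0) vi0 => [i ->|->]; last by rewrite v0 eqxx.
  exact: IHm vx i.
rewrite mulrDr => /eqP; rewrite addr_eq0 => /eqP vx _.
exists e, (- g (v ord0)^-1 * \sum_(i < m) g (v (lift ord0 i)) * x ^+ i).
transitivity (x ^+ e * g (v ord0) * g (v ord0)^-1).
  by rewrite -mulrA -rmorphM mulfV // rmorph1 mulr1.
rewrite vx mulrA exprSr; ring.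
Qed.

Lemma module_finite_spans : module_finite g -> exists n (c : 'I_n -> C), spans c.
Proof. by move=> [n [c h]]; exists n, c => x; have [z ->] := h x; exists z. Qed.

Lemma coordinates n (c : 'I_n -> C) : spans c -> indep c ->
  exists co : C -> 'I_n -> k,
    [/\ forall x, x = \sum_i g (co x i) * c i,
        forall z i, co (\sum_i g (z i) * c i) i = z i,
        forall x y i, co (x + y) i = co x i + co y i &
        forall a x i, co (g a * x) i = a * co x i].
Proof.
move=> /choice[co coE] ind.
have uniq z i : co (\sum_i g (z i) * c i) i = z i.
  apply/eqP; rewrite -subr_eq0; apply/eqP.
  apply: (ind (fun i => co (\sum_i g (z i) * c i) i - z i)).
  under eq_bigr do rewrite rmorphB mulrBl.
  by rewrite sumrB -coE subrr.
exists co; split=> // [x y i|a x i].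
  rewrite -(uniq (fun i => co x i + co y i)); congr (co _ i).
  by under eq_bigr do rewrite rmorphD mulrDl; rewrite big_split -!coE.
rewrite -(uniq (fun i => a * co x i)); congr (co _ i).
by under eq_bigr do rewrite rmorphM -mulrA; rewrite -mulr_sumr -coE.
Qed.

End FiniteOverField.

(** A nonconstant factor of least degree is irreducible, and a root of it can be adjoined. *)
Lemma adjoin_root (k : fieldType) (q : {poly k}) : (1 < size q)%N ->
  exists (L : fieldExtType k) (y : L), root (map_poly (in_alg L) q) y.
Proof.
move=> q1; pose good n := `[< exists r : {poly k}, [/\ r %| q, (1 < size r)%N & size r = n] >].
have ex : exists n, good n by exists (size q); apply/asboolP; exists q.
case: (ex_minnP ex) => n /asboolP[r [rq r1 rn]] min.
have irr : irreducible_poly r.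
  split=> // s s1 sr.
  rewrite -dvdp_size_eqp // eqn_leq dvdp_leq ?rn //=; last first.
    by rewrite -size_poly_gt0 (ltn_trans _ r1).
  apply: min; apply/asboolP; exists s; split=> //; first exact: dvdp_trans rq.
  rewrite ltn_neqAle eq_sym s1 size_poly_gt0; apply: contraTneq r1 => s0.
  by move: sr; rewrite s0 dvd0p => /eqP->; rewrite size_poly0.
have [L _ [y yr _]] := irredp_FAdjoin irr; exists L, y.
by case/dvdpP: rq => r' ->; rewrite rmorphM rootM yr orbT.
Qed.

Lemma adjoin_nth_roots (k : fieldType) n (s : seq k) : (0 < n)%N ->
  exists L : fieldExtType k, forall z, z \in s -> exists y : L, y ^+ n = in_alg L z.
Proof.
move=> n0; elim: s => [|z s [L Ls]].
  by exists (k^o : fieldExtType k).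
have [|L' [y yr]] := @adjoin_root L ('X^n - (in_alg L z)%:P).
  by rewrite size_XnsubC.
(* [L'] was built over [L]; [baseFieldType] views it as a finite extension of [k]. *)
exists (baseFieldType L'); move=> t; rewrite inE => /predU1P[->|/Ls[x xE]].
  exists y; move: yr; rewrite rmorphB /= map_polyXn map_polyC /root !hornerE subr_eq0.
  by move/eqP.
exists (in_alg L' x); have := rmorphXn (in_alg L') n x; rewrite xE; exact: esym.
Qed.

Section TensorBasis.
Variables (k L : fieldType) (C : comPzRingType).
Variables (u : {rmorphism k -> L}) (g : {rmorphism k -> C}).

Lemma tens_inl_mul (l : L) (x : C) :
  tens_inl u g l * tens_r u g 1 x = tens_r u g l x.
Proof. by rewrite tens_rM mulr1 mul1r. Qed.

Lemma tens_sumr n (l : L) (F : 'I_n -> C) :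
  tens_r u g l (\sum_i F i) = \sum_i tens_r u g l (F i).
Proof.
rewrite -tens_inl_mul -[tens_r u g 1 _]/(tens_inr u g _) rmorph_sum mulr_sumr.
by apply: eq_bigr => i _; rewrite tens_inl_mul.
Qed.

Lemma tens_spans n (c : 'I_n -> C) :
  spans g c -> spans (tens_inl u g) (fun i => tens_r u g 1 (c i)).
Proof.
move=> spc; elim/tensor_ring_ind => [|l x|z w [y ->] [y' ->]].
- by exists (fun=> 0); rewrite big1 // => i _; rewrite rmorph0 mul0r.
- have [z ->] := spc x; exists (fun i => l * u (z i)); rewrite tens_sumr.
  apply: eq_bigr => i _.
  by rewrite tens_inl_mul -tens_r_bal mulrC.
- exists (fun i => y i + y' i); rewrite -big_split; apply: eq_bigr => i _.
  by rewrite rmorphD mulrDl.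
Qed.

(** The i-th coordinate function of C over k extends to the tensor product and reads off the i-th
    coefficient there. *)
Lemma tens_indep n (c : 'I_n -> C) : spans g c -> indep g c ->
  indep (tens_inl u g) (fun i => tens_r u g 1 (c i)).
Proof.
move=> spc indc; have [co [coE coz coD coM]] := coordinates spc indc.
move=> z z0 i.
pose phi (l : alg_of u) (x : alg_of g) : L := l * u (co x i).
have bal : balanced phi.
  split=> [l l' x|l x x'|a l x]; rewrite /phi.
  - by rewrite mulrDl.
  - by rewrite coD rmorphD mulrDr.
  - by rewrite !alg_ofZ coM rmorphM mulrCA mulrA.
have coc j : co (c j) i = (i == j)%:R.
  rewrite -(coz (fun i => (i == j)%:R)); congr (co _ i).
  rewrite (bigD1 j) //= eqxx rmorph1 mul1r big1 ?addr0 // => l /negPf->.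
  by rewrite rmorph0 mul0r.
have phiE : tens_lift phi (\sum_j tens_inl u g (z j) * tens_r u g 1 (c j)) =
    \sum_j z j * u (i == j)%:R.
  elim/big_rec2: _ => [|j x y _ IH]; first exact: tens_lift0.
  rewrite tens_liftD // IH tens_inl_mul [tens_lift _ _]tens_lift_tens // /phi coc //.
move: phiE; rewrite z0 tens_lift0 // (bigD1 i) //= eqxx rmorph1 mulr1 big1 ?addr0 //.
by move=> j ji; rewrite eq_sym (negPf ji) rmorph0 mulr0.
Qed.

End TensorBasis.

(** * Dimension zero: regular rings and reduced rings *)

Definition pi_regular (D : comPzRingType) : Prop :=
  forall x : D, exists n (y : D), x ^+ n = x ^+ n.+1 * y.

Definition reduced (D : comPzRingType) : Prop := forall x : D, x * x = 0 -> x = 0.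

Lemma reduced_exp (D : comPzRingType) (x : D) n : reduced D -> x ^+ n = 0 -> x = 0.
Proof.
move=> redD; elim: n => [|[|n] IHn]; rewrite ?expr1 //.
  by rewrite expr0 => e; rewrite -[x]mulr1 e mulr0.
move=> xn; apply: IHn; apply: redD.
by rewrite -exprD addnS -addSn exprD xn mul0r.
Qed.

Section Localization.
Variables (D : comPzRingType) (P : spec D).
Local Notation loc := (localization P).
Local Notation fr := (Defs.frac (@zero_is_ideal D)).

Lemma locM a (s : denom P) b t : fr a s * fr b t = fr (a * b) (denomM s t) :> loc.
Proof. exact: frac_mulE. Qed.

Lemma loc_eq0 a (s : denom P) : fr a s = 0 :> loc <-> exists w : denom P, val w * a = 0.
Proof.
split=> [/fracP[w /=]|[w wa]].
  by rewrite mulr1 mul0r subr0; exists w.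
by apply/fracP; exists w; rewrite /= mulr1 mul0r subr0.
Qed.

Lemma loc_neq10 : 1 <> 0 :> loc.
Proof.
move=> /loc_eq0[w]; rewrite mulr1 => w0.
by apply: (denomP (s := w)); rewrite w0; case: (spec_ideal P).
Qed.

Lemma loc_unit a (s : denom P) : ~ spec_set P a -> exists y : loc, (fr a s : loc) * y = 1.
Proof.
move=> nPa; exists (fr (val s) (Denom nPa)); rewrite locM.
by apply: frac_eq => /=; ring.
Qed.

Lemma loc_pi_regular : pi_regular D ->
  forall z : loc, exists n (y : loc), z ^+ n = z ^+ n.+1 * y.
Proof.
move=> piD; elim/fracW=> a s; have [n [y yE]] := piD a.
pose t : {rmorphism D -> loc} := to_frac P (@zero_is_ideal D).
exists n, (fr (val s * y) (denom1 P)); rewrite exprSr -mulrA.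
have -> : (fr a s : loc) * fr (val s * y) (denom1 P) = t (a * y).
  by rewrite locM; apply: frac_eq => /=; ring.
have -> : fr a s = t a * fr 1 s :> loc.
  by rewrite locM; apply: frac_eq => /=; ring.
by rewrite exprMn -rmorphXn mulrAC -rmorphM mulrA -exprSr -yE.
Qed.

End Localization.

Section PiRegular.
Variable E : comPzRingType.
Hypothesis piE : forall z : E, exists n (y : E), z ^+ n = z ^+ n.+1 * y.

Lemma pi_regular_prime_max (P Q : spec E) : P `<=` Q -> Q `<=` P.
Proof.
move=> PQ x Qx; have [n [y yE]] := piE x.
have [[P0 PD PM] P1 prP] := specP P; have [[Q0 QD QM] Q1 prQ] := specP Q.
have : spec_set P (x ^+ n * (1 - x * y)) by rewrite mulrBr mulr1 mulrA -exprSr -yE subrr.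
move=> /prP[|/PQ Q1xy]; last first.
  by case: Q1; rewrite -(subrK (x * y) 1); apply: QD => //; rewrite mulrC; apply: QM.
by elim: n {yE} => [//|n IHn]; rewrite exprS => /prP[|/IHn].
Qed.

Lemma pi_regular_dim0 d : krull_dim E d -> d = 0%N.
Proof.
case: d => // d [[c chain] _].
have [] := chain ord0 (lift ord0 ord0) isT.
by move=> /pi_regular_prime_max h nh; case: nh.
Qed.

End PiRegular.

(** A nonzero x with x^2 = 0 survives in the localization at a prime containing its annihilator.
    That local ring has dimension 0, so regularity generates its maximal ideal by 0 elements. *)
Lemma regular_reduced (D : comPzRingType) : pi_regular D -> regular_ring D -> reduced D.
Proof.
move=> piD [noethD regD] x xx; apply: contrapT => x0.
pose ann : set D := [set y | y * x = 0].
have idann : is_ideal ann.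
  split=> [|y z yx zx|a y yx]; rewrite /ann /= ?mul0r //.
    by rewrite mulrDl yx zx addr0.
  by rewrite -mulrA yx mulr0.
have [||y ax y1|Q prQ [annQ _]] := @prime_avoiding D [set 1] ann noethD _ _ idann.
- by [].
- by move=> y z -> ->; rewrite /= mulr1.
- by apply: x0; move: ax; rewrite y1 /ann /= mul1r.
pose P := Spec prQ.
have [_ [m [maxm _ [d dimd [gm mE]]]]] := regD P.
have d0 := pi_regular_dim0 (loc_pi_regular (P := P) piD) dimd.
pose z : localization P := Defs.frac (@zero_is_ideal D) x (denom1 P).
have m0 y : m y -> y = 0.
  by rewrite mE => -[c ->]; rewrite big1 // => i; exfalso; move: i; rewrite d0 => -[].
have zz : z * z = 0.
  by rewrite locM; apply/loc_eq0; exists (denom1 P); rewrite mul1r.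
have [_ _ maxm'] := maxm.
have Jz : is_ideal [set y : localization P | exists a, y = a * z].
  split=> [|_ _ [a ->] [b ->]|a _ [b ->]].
  - by exists 0; rewrite mul0r.
  - by exists (a + b); rewrite mulrDl.
  - by exists (a * b); rewrite mulrA.
(* The ideal (z) is proper because z^2 = 0, and it contains m = 0; maximality of m gives (z) = m, so
   z = 0. *)
have Jm : [set y : localization P | exists a, y = a * z] = m.
  apply: maxm' => // [[a a1]|y /m0->]; last by exists 0; rewrite mul0r.
  have z0 : z = 0 by rewrite -[z]mul1r a1 -mulrA zz mulr0.
  by apply: (@loc_neq10 _ P); rewrite a1 z0 mulr0.
have /loc_eq0[w wx] : z = 0 by apply: m0; rewrite -Jm; exists 1; rewrite mul1r.
by apply: (denomP (s := w)); apply: annQ.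
Qed.

Section RegularOfReduced.
Variables (L : fieldType) (D : comPzRingType) (h : {rmorphism L -> D}).
Variables (n : nat) (c : 'I_n -> D).
Hypothesis spc : spans h c.

Lemma indep_leq m (v : 'I_m -> D) : indep h v -> (m <= n)%N.
Proof.
move=> iv; have /choice[y yE] : forall i, exists y, v i = \sum_j h (y j) * c j.
  by move=> i; apply: spc.
pose B : 'M[L]_(m, n) := \matrix_(i, j) y i j.
have dE i : v i = \sum_l h (B i l) * c l.
  by rewrite yE; apply: eq_bigr => j _; rewrite mxE.
suff /eqP <- : row_free B by exact: rank_leq_col.
rewrite -kermx_eq0; apply/eqP/matrixP => i j; rewrite [RHS]mxE.
apply: (iv (kermx B i)); rewrite (sum_mulmx _ _ dE) mulmx_ker.
by rewrite big1 // => l _; rewrite mxE rmorph0 mul0r.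
Qed.

(** An L-independent family in the ideal, of largest possible size, spans it over L and hence
    generates it. *)
Lemma spans_noetherian : noetherian D.
Proof.
move=> I idI; have [I0 ID IM] := idI.
pose good m := `[< exists v : 'I_m -> D, (forall i, I (v i)) /\ indep h v >].
have ex : exists m, good m.
  by exists 0%N; apply/asboolP; exists (fun=> 0); split=> [[]|? ? []].
have bound m : good m -> (m <= n)%N by move=> /asboolP[v [_ /indep_leq]].
case: (ex_maxnP ex bound) => m /asboolP[v [Iv iv]] max.
exists m, v; apply/seteqP; split; last exact: gen_ideal_sub.
move=> x Ix; pose w (i : 'I_m.+1) := oapp v x (unlift ord0 i).
have : ~ indep h w.
  move=> iw; have : good m.+1.
    by apply/asboolP; exists w; split=> // i; rewrite /w; case: (unlift ord0 i).
  by move/max; rewrite ltnn.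
move=> /existsNP[z /not_implyP[]]; rewrite big_ord_recl {1}/w unlift_none /=.
under eq_bigr do rewrite /w liftK /=.
move=> zE /existsNP[i zi].
have [z0|z0] := eqVneq (z ord0) 0.
  move: zE; rewrite z0 rmorph0 mul0r add0r => /iv zv.
  by case: zi; case: (unliftP ord0 i) => [j ->|->//]; apply: zv.
exists (fun j => - h ((z ord0)^-1 * z (lift ord0 j))).
rewrite -[x]mul1r -(rmorph1 h) -(mulVf z0) rmorphM -mulrA.
move/eqP: zE; rewrite addr_eq0 => /eqP->; rewrite mulrN mulr_sumr -sumrN.
by apply: eq_bigr => j _; rewrite rmorphM mulrA mulNr.
Qed.

(** Every localization is a field: for a in P, a^m (1 - a y) = 0 makes (1 - a y) a nilpotent, hence
    zero, and 1 - a y lies outside P. *)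
Lemma reduced_regular : reduced D -> regular_ring D.
Proof.
move=> redD; split=> [|P]; first exact: spans_noetherian.
pose E := localization P.
have unit0 (z : E) : z = 0 \/ exists y, z * y = 1.
  elim/fracW: z => a s; have [Pa|] := pselect (spec_set P a); last first.
    by right; apply: loc_unit.
  left; have [m [y yE]] := spans_pi_regular spc a.
  have [idP P1 prP] := specP P; have [P0 PD PM] := idP.
  have nPw : ~ spec_set P (1 - a * y).
    move=> Pw; apply: P1; rewrite -(subrK (a * y) 1); apply: (PD) => //.
    by rewrite mulrC; apply: PM.
  apply/loc_eq0; exists (Denom nPw) => /=; apply: (@reduced_exp _ _ m.+1) => //.
  have e : a ^+ m * (1 - a * y) = 0.
    by rewrite mulrBr mulr1 mulrA -exprSr -yE subrr.
  have -> : ((1 - a * y) * a) ^+ m.+1 = (1 - a * y) ^+ m * a * (a ^+ m * (1 - a * y)).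
    by rewrite exprMn !exprS; ring.
  by rewrite e mulr0.
have ideals (I : set E) : is_ideal I -> ~ I 1 -> I = [set 0].
  move=> [I0 _ IM] I1; apply/seteqP; split=> [z Iz|_ -> //].
  by case: (unit0 z) => // -[y zy]; case: I1; rewrite -zy mulrC; apply: IM.
have gen0 (g : 'I_0 -> E) : [set 0] = gen_ideal g.
  apply/seteqP; split=> [_ ->|_ [d ->]]; last by rewrite big_ord0.
  by exists (fun=> 0); rewrite big_ord0.
have n10 : ~ [set 0] (1 : E) by exact: loc_neq10.
have pr0 : is_prime [set (0 : E)].
  split=> // [|x y /= xy]; first exact: zero_is_ideal.
  have [->|[z xz]] := unit0 x; first by left.
  by right; rewrite -[y]mul1r -xz mulrAC xy mul0r.
split.
  move=> I idI; have [I1|I1] := pselect (I 1).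
    exists 1%N, (fun=> 1); apply/seteqP; split=> [x Ix|_ [d ->]].
      by exists (fun=> x); rewrite big_ord1 mulr1.
    by rewrite big_ord1; case: idI => _ _; apply.
  by exists 0%N, (fun=> 0); rewrite (ideals I) //; exact: gen0.
exists [set 0]; split.
- split=> //; first exact: zero_is_ideal.
  by move=> J idJ J1 _; apply: ideals.
- by move=> m [idm m1 _]; apply: ideals.
- exists 0%N; last by exists (fun=> 0); exact: gen0.
  split; first by exists (fun=> Spec pr0) => i j; rewrite !ord1.
  move=> [//|m] ch chain; have := chain ord0 (lift ord0 ord0) isT.
  have spec0 (Q : spec E) : spec_set Q = [set 0].
    by case: (specP Q) => idQ Q1 _; apply: ideals.
  by case; rewrite !spec0.
Qed.

End RegularOfReduced.

(** * Geometric regularity through powers of a basis *)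

Section Geometric.
Variables (p : nat) (pr_p : prime p) (k : fieldType) (chk : p%:R = 0 :> k).
Variables (C : comPzRingType) (g : {rmorphism k -> C}).
Variables (n : nat) (c : 'I_n -> C).
Hypotheses (spc : spans g c) (indc : indep g c).

Lemma tens_char (L : fieldType) (u : {rmorphism k -> L}) :
  p%:R = 0 :> tensor_ring u g.
Proof.
by rewrite -(rmorph_nat (tens_inl u g)) -(rmorph_nat u) chk !rmorph0.
Qed.

Lemma geom_regular_indep e :
  geometrically_regular g -> indep g (fun i => c i ^+ (p ^ e)).
Proof.
move=> georeg z zc i.
(* All coefficients get their roots in one finite extension, the only kind of extension over which
   geometric regularity is tested. *)
have [|L Lz] := @adjoin_nth_roots k (p ^ e) (codom z).
  by rewrite expn_gt0 prime_gt0.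
have /choice[y yE] : forall i, exists y : L, y ^+ (p ^ e) = in_alg L (z i).
  by move=> j; apply/Lz/codom_f.
pose u : {rmorphism k -> L} := in_alg L.
pose D := tensor_ring u g.
have spD := tens_spans (u := u) spc.
have redD : reduced D.
  by apply: regular_reduced (georeg L) => x; apply: spans_pi_regular spD x.
pose x : D := \sum_i tens_inl u g (y i) * tens_r u g 1 (c i).
have x0 : x = 0.
  apply: (@reduced_exp _ _ (p ^ e)) => //; rewrite (expr_sum_charn pr_p (tens_char u)).
  transitivity (tens_r u g 1 (\sum_i g (z i) * c i ^+ (p ^ e))); last first.
    by rewrite zc; exact: (rmorph0 (tens_inr u g)).
  rewrite tens_sumr; apply: eq_bigr => j _.
  rewrite exprMn -rmorphXn yE -[tens_r u g 1 (c j)]/(tens_inr u g (c j)) -rmorphXn.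
  by rewrite [LHS]tens_inl_mul -[in LHS](mulr1 (in_alg L _)) tens_r_bal.
have y0 := tens_indep (u := u) spc indc x0 i.
have := yE i; rewrite y0 expr0n expn_eq0 (gtn_eqF (prime_gt0 pr_p)) /=.
by move/esym/eqP; rewrite scaler_eq0 oner_eq0 orbF => /eqP.
Qed.

(** The exponent p is enough: x^2 = 0 already gives x^p = 0. By [indep_spans] the c_i^p form a
    basis, which stays one over L, so the p-th powers of the coordinates of x vanish. *)
Lemma indep_geom_regular :
  indep g (fun i => c i ^+ p) -> geometrically_regular g.
Proof.
move=> indp L; pose u : {rmorphism k -> L} := in_alg L.
apply: (reduced_regular (tens_spans (u := u) spc)) => x xx.
have spp := indep_spans spc indp.
have [z xE] := tens_spans (u := u) spc x.
have xp : x ^+ p = \sum_i tens_inl u g (z i ^+ p) * tens_r u g 1 (c i ^+ p).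
  rewrite xE -[in X in X = _](expn1 p) (expr_sum_charn pr_p (tens_char u)).
  apply: eq_bigr => i _; rewrite expn1 exprMn -rmorphXn; congr (_ * _).
  by rewrite -[tens_r u g 1 (c i)]/(tens_inr u g (c i)) -rmorphXn.
have xp0 : x ^+ p = 0.
  by rewrite -(subnK (prime_gt1 pr_p)) exprD expr2 xx mulr0.
rewrite xE big1 // => i _; move: xp; rewrite xp0.
move=> /esym/(tens_indep (u := u) spp indp)/(_ i)/eqP.
by rewrite expf_eq0 => /andP[_ /eqP->]; rewrite rmorph0 mul0r.
Qed.

End Geometric.

(** * Fibres *)

Section ResidueMap.
Variables (R R' : comPzRingType) (u : {rmorphism R -> R'}) (P : spec R) (Q : spec R').
Variables (I : set R') (idI : is_ideal I).
Variables (uI : forall a, spec_set P a -> I (u a)).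
Variables (uP : forall s, ~ spec_set P s -> ~ spec_set Q (u s)).

Definition denom_map (s : denom P) : denom Q := Denom (uP (denomP (s := s))).

(** The map from kappa(P) to (R'/I)_Q induced by u. It serves twice: for u = f with I = PB, and for
    u the Frobenius with I containing P^[q]. *)
Definition residue_map of (forall a, spec_set P a -> I (u a)) :=
  fun z : residue_field P =>
  Defs.frac idI (u (repr z).1) (denom_map (repr z).2) : frac_ring Q idI.
Local Notation rmap := (residue_map uI).

Lemma residue_mapE a s :
  rmap (Defs.frac (spec_ideal P) a s) = Defs.frac idI (u a) (denom_map s).
Proof.
rewrite /residue_map; have /fracP[w Pw] := frac_repr (Defs.frac (spec_ideal P) a s).
move: (repr (Defs.frac (spec_ideal P) a s)) Pw => [a' s'] /= Pw.
apply/fracP; exists (denom_map w) => /=.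
by rewrite -!rmorphM -rmorphB -rmorphM; exact: uI.
Qed.

Fact residue_map_is_zmod : zmod_morphism rmap.
Proof.
have rmapD x y : rmap (x + y) = rmap x + rmap y.
  elim/fracW: x => a s; elim/fracW: y => b t.
  rewrite [_ + _]frac_addE !residue_mapE [RHS]frac_addE.
  by apply: frac_eq => /=; rewrite rmorphD !rmorphM.
by move=> x y; apply: (canRL (addrK _)); rewrite -rmapD subrK.
Qed.

Fact residue_map_is_monoid : monoid_morphism rmap.
Proof.
split=> [|x y].
  by rewrite [LHS]residue_mapE; apply: frac_eq => /=; rewrite !rmorph1.
elim/fracW: x => a s; elim/fracW: y => b t.
rewrite [X in rmap X]frac_mulE !residue_mapE [RHS]frac_mulE.
by apply: frac_eq => /=; rewrite !rmorphM.
Qed.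

HB.instance Definition _ :=
  GRing.isZmodMorphism.Build (residue_field P) (frac_ring Q idI) rmap residue_map_is_zmod.
HB.instance Definition _ :=
  GRing.isMonoidMorphism.Build (residue_field P) (frac_ring Q idI) rmap residue_map_is_monoid.

Lemma residue_map_to a : rmap (to_residue P a) = to_frac Q idI (u a).
Proof. by rewrite [LHS]residue_mapE; apply: frac_eq => /=; rewrite rmorph1. Qed.

End ResidueMap.

Section Residue.
Variables (R : comPzRingType) (P : spec R).

Lemma to_residue_eq0 a : to_residue P a = 0 <-> spec_set P a.
Proof. exact: residue_eq0. Qed.

Lemma prime_prod n (F : 'I_n -> R) : (forall i, ~ spec_set P (F i)) ->
  ~ spec_set P (\prod_i F i).
Proof.
have [_ P1 prP] := specP P.
by move=> nF; elim/big_ind: _ => // x y nx ny /prP[].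
Qed.

Lemma common_multiple n (K : 'I_n -> R -> Prop) :
  (forall i a b, K i a -> K i (a * b)) ->
  (forall i, exists2 a, ~ spec_set P a & K i a) ->
  exists2 a, ~ spec_set P a & forall i, K i a.
Proof.
move=> KM ex; have /choice[a aP] : forall i, exists a, ~ spec_set P a /\ K i a.
  by move=> i; have [a] := ex i; exists a.
exists (\prod_i a i).
  by apply: prime_prod => i; case: (aP i).
by move=> i; rewrite (bigD1 i) //=; apply: KM; case: (aP i).
Qed.

Lemma clear_denominators n (z : 'I_n -> residue_field P) :
  exists2 s, ~ spec_set P s &
    exists a : 'I_n -> R, forall i, to_residue P s * z i = to_residue P (a i).
Proof.
pose K i s := exists a, to_residue P s * z i = to_residue P a.
have [|i|s nPs Ks] := @common_multiple n K.
- by move=> i s b [a e]; exists (a * b); rewrite !rmorphM mulrAC e.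
- rewrite /K; elim/fracW: (z i) => a s; exists (val s); first exact: denomP.
  by exists a; rewrite [LHS]frac_mulE; apply: frac_eq => /=; ring.
- by exists s => //; have /choice[a aE] : forall i, K i s := Ks; exists a.
Qed.

End Residue.

Section Fiber.
Variables (A B : comPzRingType) (f : {rmorphism A -> B}) (P : spec A).
Local Notation inr := (tens_inr (to_residue P) f).
Local Notation BA := (alg_of f).

Lemma ispan_extension (I : set A) : is_ideal [set b : B | ispan I (b : BA)].
Proof.
split=> [|x y|b x] /=; [exact: ispan0|exact: ispanD|].
elim=> [|a m z Ia _ IH]; first by rewrite mulr0; exact: ispan0.
rewrite [_ * _](mulrDr (b : B)); apply: ispanD => //.
by rewrite alg_ofZ mulrCA; exact: (ispanZ (b * m : BA) Ia).
Qed.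

Lemma to_fiberM a (x : B) : to_fiber f P (to_residue P a) * inr x = inr (f a * x).
Proof. by rewrite [to_fiber _ _ _]tens_inlr -rmorphM. Qed.

Lemma inr_ispan (x : BA) : ispan P x -> inr x = 0.
Proof.
elim=> [|a m z Pa _ IH]; first exact: (rmorph0 inr).
have -> : inr (a *: m + z) = inr (f a * m) + inr z := rmorphD inr _ _.
rewrite IH addr0 -to_fiberM.
by have /to_residue_eq0-> := Pa; rewrite rmorph0 mul0r.
Qed.

(** If every multiplier failed, (PB : x) would avoid the image of A - P and so lie in a prime Q of B
    avoiding it. The fibre maps to (B/PB)_Q, where x becomes 0: some w outside Q lies in (PB : x), a
    contradiction. *)
Lemma fiber_ker (x : BA) : noetherian B -> inr x = 0 ->
  exists2 a, ~ spec_set P a & ispan P (a *: x).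
Proof.
move=> noethB x0; apply: contrapT => nx.
have idPB := ispan_extension P; have [[P0 PD PM] P1 prP] := specP P.
pose S : set B := [set s | exists2 a, ~ spec_set P a & s = f a].
have [|_ _ [a na ->] [b nb ->]| z Jz [a na zE] |Q0 prQ [JQ QS]] :=
  @prime_avoiding B S (colon [set b : B | ispan P (b : BA)] x) noethB _ _
    (colon_is_ideal _ idPB).
- by exists 1 => //; rewrite rmorph1.
- by exists (a * b); [move=> /prP[]|rewrite rmorphM].
- by apply: nx; exists a => //; move: Jz; rewrite zE.
pose Q := Spec prQ.
have fP s : ~ spec_set P s -> ~ spec_set Q (f s).
  by move=> nPs Qs; apply: (QS _ Qs); exists s.
have fI a : spec_set P a -> ispan P (f a : BA).
  by move=> Pa; rewrite -[f a]mulr1; exact: (ispanZ (1 : BA) Pa).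
pose k : {rmorphism residue_field P -> frac_ring Q idPB} := residue_map idPB fP fI.
pose v : {rmorphism B -> frac_ring Q idPB} := to_frac Q idPB.
have kv : k \o to_residue P =1 v \o f by move=> a; exact: residue_map_to.
have : tens_ring_lift kv (inr x) = v x by rewrite [LHS]tens_ring_liftE rmorph1 mul1r.
rewrite x0 rmorph0 => /esym/fracP[w] /=; rewrite mulr1 mul0r subr0 => wx.
by apply: (denomP (s := w)); apply: JQ.
Qed.

Lemma fiber_num (c : fiber f P) : exists2 s, ~ spec_set P s &
  exists b, to_fiber f P (to_residue P s) * c = inr b.
Proof.
have [_ P1 prP] := specP P.
elim/tensor_ring_ind: c => [|z b|c d [s ns [x xE]] [t nt [y yE]]].
- by exists 1 => //; exists 0; rewrite mulr0 rmorph0.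
- elim/fracW: z => a s; exists (val s); first exact: denomP.
  exists (f a * b); rewrite -to_fiberM [LHS]tens_rM mul1r [RHS]tens_rM mul1r mulr1.
  by congr tens_r; rewrite [LHS]frac_mulE; apply: frac_eq => /=; ring.
- exists (s * t); first by move=> /prP[].
  exists (f t * x + f s * y).
  have -> : inr (f t * x + f s * y) = inr (f t * x) + inr (f s * y) := rmorphD inr _ _.
  by rewrite -!to_fiberM -xE -yE !rmorphM; ring.
Qed.

Lemma fiber_basis : module_finite (to_fiber f P) -> exists n (b : 'I_n -> B),
  spans (to_fiber f P) (fun i => inr (b i)) /\ indep (to_fiber f P) (fun i => inr (b i)).
Proof.
move=> /module_finite_spans[n [c spc]].
have /choice[b bE] : forall i, exists b, exists2 s, ~ spec_set P s &
    to_fiber f P (to_residue P s) * c i = inr b.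
  by move=> i; have [s ns [b bE]] := fiber_num (c i); exists b, s.
have spb : spans (to_fiber f P) (fun i => inr (b i)).
  have /choice[t tE] : forall i, exists t, c i = to_fiber f P t * inr (b i).
    move=> i; have [s ns <-] := bE i; exists (to_residue P s)^-1.
    rewrite mulrA -rmorphM mulVf ?rmorph1 ?mul1r //.
    by apply/eqP => /to_residue_eq0.
  move=> x; have [z ->] := spc x; exists (fun i => z i * t i).
  by apply: eq_bigr => i _; rewrite tE rmorphM mulrA.
have [m [s [spbs ibs]]] := extract_basis spb.
by exists m, (b \o s).
Qed.

Lemma fiber_approx n (b : 'I_n -> B) : noetherian B ->
  spans (to_fiber f P) (fun i => inr (b i)) ->
  forall y : BA, exists2 s, ~ spec_set P s &
    exists a : 'I_n -> A, ispan P (s *: y - \sum_i a i *: (b i : BA)).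
Proof.
move=> noethB spb y; have [_ P1 prP] := specP P.
have [z yE] := spb (inr y); have [s ns [a aE]] := clear_denominators z.
have [|w nw ws] := @fiber_ker (s *: y - \sum_i a i *: (b i : BA)) noethB.
  have -> : inr (s *: y - \sum_i a i *: (b i : BA)) =
      inr (f s * y) - \sum_i inr (f (a i) * b i).
    by rewrite -(rmorph_sum inr) -(rmorphB inr).
  rewrite -to_fiberM yE mulr_sumr; apply/eqP; rewrite subr_eq0; apply/eqP.
  apply: eq_bigr => i _; rewrite mulrA -rmorphM aE to_fiberM //.
exists (w * s); first by move=> /prP[].
exists (fun i => w * a i); move: ws; rewrite scalerBr scalerA scaler_sumr.
by under eq_bigr do rewrite scalerA.
Qed.

Lemma fiber_indep n (b : 'I_n -> B) (a : 'I_n -> A) :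
  indep (to_fiber f P) (fun i => inr (b i)) ->
  ispan P (\sum_i a i *: (b i : BA)) -> forall i, spec_set P (a i).
Proof.
move=> ib /inr_ispan ab i; apply/to_residue_eq0.
apply: (ib (fun i => to_residue P (a i))); rewrite -[RHS]ab (rmorph_sum inr).
by apply: eq_bigr => j _; rewrite to_fiberM.
Qed.

Lemma fiber_relation n (b : 'I_n -> B) : noetherian B ->
  (forall a : 'I_n -> A, ispan P (\sum_i a i *: (b i : BA)) -> forall i, spec_set P (a i)) ->
  indep (to_fiber f P) (fun i => inr (b i)).
Proof.
move=> noethB ab z z0 i; have [_ P1 prP] := specP P.
have [s ns [a aE]] := clear_denominators z.
have [|w nw] := @fiber_ker (\sum_i a i *: (b i : BA)) noethB.
  transitivity (to_fiber f P (to_residue P s) * \sum_i to_fiber f P (z i) * inr (b i)).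
    2: by rewrite z0 mulr0.
  rewrite (rmorph_sum inr) mulr_sumr.
  by apply: eq_bigr => j _; rewrite mulrA -rmorphM aE to_fiberM.
rewrite scaler_sumr; under eq_bigr do rewrite scalerA.
move=> /ab/(_ i)/prP[//|/to_residue_eq0 ai].
have := aE i; rewrite ai => /eqP; rewrite mulf_eq0 => /orP[/eqP/to_residue_eq0//|/eqP//].
Qed.

End Fiber.

(** The torsion elements modulo PB form an ideal of B; multiplying together multipliers for finitely
    many generators kills all of it. *)
Lemma torsion_bound (A B : comPzRingType) (f : {rmorphism A -> B}) (P : set A) :
  noetherian B -> is_prime P -> exists2 a, ~ P a & forall t : alg_of f,
    (exists2 a', ~ P a' & ispan P (a' *: t)) -> ispan P (a *: t).
Proof.
move=> noethB prP; pose PP := Spec prP; have [_ P1 prP'] := prP.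
have [I0 ID IM] := ispan_extension f P.
have idT : is_ideal [set t : B | exists2 a', ~ P a' & ispan P (a' *: (t : alg_of f))].
  split=> [|x y [a na ax] [b nb bx]|b x [a na ax]].
  - by exists 1 => //; rewrite scaler0; exact: ispan0.
  - exists (a * b); first by move=> /prP'[].
    rewrite scalerDr; apply: ispanD; last by rewrite -scalerA; exact: ispan_scale.
    by rewrite mulrC -scalerA; exact: ispan_scale.
  - by exists a => //; rewrite alg_ofZ mulrCA; apply: IM.
have [n [t tE]] := noethB _ idT.
have [|i|a na at_] := @common_multiple A PP n (fun i a => ispan P (a *: (t i : alg_of f))).
- by move=> i a b at_; rewrite mulrC -scalerA; exact: ispan_scale.
- by have : gen_ideal t (t i) := gen_ideal_mem t i; rewrite -tE.
exists a => // x Tx; have : gen_ideal t x by rewrite -tE.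
case=> c ->; rewrite scaler_sumr; apply: ispan_sum => i.
rewrite alg_ofZ mulrCA; exact: (IM _ _ (at_ i)).
Qed.

(** * Radu-Andre homomorphisms *)

Section RaduAndreFiber.
Variables (p : nat) (pr_p : prime p) (A B : comPzRingType).
Variables (chA : p%:R = 0 :> A) (chB : p%:R = 0 :> B).
Variables (noethA : noetherian A) (noethB : noetherian B).
Variables (f : {rmorphism A -> B}) (e : nat).
Local Notation q := (p ^ e)%N.
Local Notation F := (frobenius e pr_p chA).
Local Notation U := (alg_of (tens_inr f F)).
Local Notation BA := (alg_of f).
Local Notation tr := (tens_r f F).

Definition radu_linear : {linear U -> BA} := alg_linear (radu_andre_inr pr_p chA chB f e).

Lemma radu_linearE b a : radu_linear (tr b a) = a *: (b ^+ q : BA).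
Proof. by rewrite [LHS]radu_andreE alg_ofZ mulrC. Qed.

Lemma radu_linear_sum n (b : 'I_n -> B) (a : 'I_n -> A) :
  radu_linear (\sum_i a i *: (tr (b i) 1 : U)) = \sum_i a i *: (b i ^+ q : BA).
Proof.
rewrite linear_sum; apply: eq_bigr => i _.
by rewrite tens_inrZ radu_linearE mulr1.
Qed.

Section AtPrime.
Variable P : spec A.
Local Notation inr := (tens_inr (to_residue P) f).

Lemma q_gt0 : (0 < q)%N. Proof. by rewrite expn_gt0 prime_gt0. Qed.

Lemma frob_power_prime : frob_power q P `<=` P.
Proof.
have [idP _ _] := specP P; apply: frob_power_sub => // y Py.
by rewrite -(prednK q_gt0) exprSr; case: idP => _ _; apply.
Qed.

(** A scalar crosses the tensor sign as its q-th power; hence P on the left becomes P^[q] on the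
    right. *)
Lemma tr_ispan (x : BA) a : ispan P x -> ispan (frob_power q P) (tr x a : U).
Proof.
elim=> [|c m z Pc _ IH].
  by rewrite -[tr 0 a]/(tens _ _) -(scale0r (0 : BA)) tensZl scale0r; exact: ispan0.
rewrite tens_rDl; apply: ispanD => //.
rewrite alg_ofZ tens_r_bal -tens_inrZ; apply: ispanZ.
exact: frob_power_mem.
Qed.

Variables (n : nat) (b : 'I_n -> B).
Hypotheses (spb : spans (to_fiber f P) (fun i => inr (b i))).
Hypotheses (ib : indep (to_fiber f P) (fun i => inr (b i))).

Lemma source_approx (s : U) : exists2 d, ~ spec_set P d & exists a : 'I_n -> A,
  ispan (frob_power q P) (d *: s - \sum_i a i *: (tr (b i) 1 : U)).
Proof.
have [_ P1 prP] := specP P.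
elim/tensor_ring_ind: s => [|y c|z w [d nd [a az]] [d' nd' [a' aw]]].
- exists 1 => //; exists (fun=> 0); rewrite scaler0 big1 ?subr0; first exact: ispan0.
  by move=> i _; rewrite scale0r.
- have [s ns [a sy]] := fiber_approx noethB spb y.
  (* The multiplier s acts on the left factor; seen from the right factor it is s^q. *)
  exists (s ^+ q).
    elim: (q) => [|m IHm]; first by rewrite expr0.
    by rewrite exprS => /prP[].
  exists (fun i => a i ^+ q * c).
  have -> : s ^+ q *: (tr y c : U) = tr (f s * y) c by rewrite tens_inrZ tens_r_bal.
  have -> : \sum_i (a i ^+ q * c) *: (tr (b i) 1 : U) = tr (\sum_i f (a i) * b i) c.
    elim/big_rec2: _ => [|i x z _ IH].
      by rewrite -[tr 0 c]/(tens _ _) -(scale0r (0 : BA)) tensZl scale0r.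
    by rewrite IH tens_rDl tens_inrZ mulr1 tens_r_bal.
  have -> : tr (f s * y) c - tr (\sum_i f (a i) * b i) c =
      tr (f s * y - \sum_i f (a i) * b i) c.
    by apply: (canLR (addrK _)); rewrite -tens_rDl subrK.
  exact: tr_ispan.
- exists (d * d'); first by move=> /prP[].
  exists (fun i => d' * a i + d * a' i).
  have -> : (d * d') *: (z + w : U) - \sum_i (d' * a i + d * a' i) *: (tr (b i) 1 : U) =
    d' *: (d *: (z : U) - \sum_i a i *: (tr (b i) 1 : U)) +
    d *: (d' *: (w : U) - \sum_i a' i *: (tr (b i) 1 : U)).
    under eq_bigr do rewrite scalerDl -!scalerA.
    rewrite big_split -!scaler_sumr !scalerBr !scalerDr !scalerA (mulrC d').
    by rewrite opprD addrACA.
  by apply: ispanD; apply: ispan_scale.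
Qed.

(** The i-th coordinate in the fibre, pushed along the map kappa(P) -> (A/I)_P induced by the
    Frobenius, extends to a functional [Phi] on S_e that reads off a_i. It is applied with I = P and
    with I = P^[q]. *)
Lemma source_relation (I : set A) (a : 'I_n -> A) : is_ideal I ->
  (forall y, spec_set P y -> I (y ^+ q)) ->
  ispan I (\sum_i a i *: (tr (b i) 1 : U)) ->
  exists2 w, ~ spec_set P w & forall i, I (w * a i).
Proof.
move=> idI PI ab; have [_ ID IM] := idI.
have [co [coE coz coD coM]] := coordinates spb ib.
have [_ P1 prP] := specP P.
have FP s : ~ spec_set P s -> ~ spec_set P (F s).
  move=> nPs; rewrite /frobenius; elim: (q) => [|m IHm]; first by rewrite expr0.
  by rewrite exprS => /prP[].
pose k : {rmorphism residue_field P -> frac_ring P idI} := residue_map idI FP PI.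
pose v : {rmorphism A -> frac_ring P idI} := to_frac P idI.
apply: (@common_multiple _ P n (fun i w => I (w * a i))) => [i w w' Iw|i].
  by rewrite mulrAC mulrC; apply: IM.
pose phi (y : BA) (c : alg_of F) : frac_ring P idI := k (co (inr y) i) * v c.
have bal : balanced phi.
  split=> [y y' c|y c c'|c y c']; rewrite /phi.
  - have -> : inr (y + y') = inr y + inr y' := rmorphD inr _ _.
    by rewrite coD rmorphD mulrDl.
  - by rewrite rmorphD mulrDr.
  - rewrite alg_ofZ -[inr _]/(inr (f c * y)) -to_fiberM coM rmorphM.
    rewrite [k (to_residue _ _)]residue_map_to alg_ofZ.
    have -> : v ((F c : alg_of F) * c') = v (F c) * v c' := rmorphM v _ _.
    by rewrite [RHS]mulrCA mulrA.
pose Phi := tens_lift phi.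
have Phi_tr y c : Phi (tr y c) = phi y c by exact: tens_lift_tens.
have PhiD x y : Phi (x + y) = Phi x + Phi y by exact: tens_liftD.
have PhiZ c x : Phi (c *: (x : U)) = v c * Phi x.
  elim/tensor_ring_ind: x => [|y d|x y xE yE].
  - by rewrite scaler0 /Phi tens_lift0 // mulr0.
  - rewrite tens_inrZ !Phi_tr /phi.
    by have -> : v (c * d) = v c * v d := rmorphM v _ _; rewrite mulrCA.
  - by rewrite scalerDr !PhiD xE yE mulrDr.
have PhiI (x : U) : ispan I x -> Phi x = 0.
  elim=> [|c m z Ic _ IH]; first exact: tens_lift0.
  have -> : Phi (c *: m + z) = v c * Phi m + Phi z.
    by apply: etrans (PhiD _ _) _; congr (_ + _); apply: PhiZ.
  suff -> : v c = 0 by rewrite IH mul0r addr0.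
  by apply/fracP; exists (denom1 P); rewrite /= mulr1 mul0r subr0 mul1r.
have coc j : co (inr (b j)) i = (i == j)%:R.
  rewrite -(coz (fun i => (i == j)%:R)); congr (co _ i).
  rewrite (bigD1 j) //= eqxx rmorph1 mul1r big1 ?addr0 // => l /negPf->.
  by rewrite rmorph0 mul0r.
have PhiE : Phi (\sum_j a j *: (tr (b j) 1 : U)) = \sum_j v (a j) * k (i == j)%:R.
  elim/big_rec2: _ => [|j x y _ IH]; first exact: tens_lift0.
  have -> : Phi (a j *: (tr (b j) 1 : U) + y) = v (a j) * Phi (tr (b j) 1) + Phi y.
    by apply: etrans (PhiD _ _) _; congr (_ + _); apply: PhiZ.
  rewrite IH; congr (_ * _ + _).
  by rewrite Phi_tr /phi coc rmorph1 mulr1.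
move: PhiE; rewrite (PhiI _ ab) (bigD1 i) //= eqxx rmorph1 mulr1 big1 ?addr0; last first.
  by move=> j ji; rewrite eq_sym (negPf ji) rmorph0 mulr0.
move=> /esym/fracP[w] /=; rewrite mulr1 mul0r subr0 => Iw.
by exists (val w) => //; exact: denomP.
Qed.

Lemma generic_inj : indep (to_fiber f P) (fun i => inr (b i ^+ q)) ->
  forall s : U, ispan P (radu_linear s) -> exists2 d, ~ spec_set P d & ispan P (d *: s).
Proof.
move=> ibq s Ps; have [d nd [a sE]] := source_approx s; exists d => //.
have sP : ispan P (d *: s - \sum_i a i *: (tr (b i) 1 : U)).
  by apply: ispan_sub sE; exact: frob_power_prime.
have aP : forall i, spec_set P (a i).
  apply: (fiber_indep ibq); rewrite -radu_linear_sum.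
  rewrite -[X in radu_linear X](subKr (d *: s)) linearB; apply: ispanB.
    by rewrite linearZ; exact: ispan_scale.
  exact: ispan_linear.
rewrite -[_ *: _](subrK (\sum_i a i *: (tr (b i) 1 : U))).
by apply: ispanD => //; apply: ispan_sum => i; apply: ispanZ.
Qed.

Lemma inj_mod_indep : inj_mod radu_linear P -> indep (to_fiber f P) (fun i => inr (b i ^+ q)).
Proof.
move=> injP; apply: fiber_relation => // a; rewrite -radu_linear_sum => /injP.
have [idP P1 prP] := specP P.
move=> /source_relation[//|y Py|w nw wa i].
  by apply: frob_power_prime; exact: frob_power_mem.
by have /prP[] := wa i.
Qed.

Lemma generic_surj : indep (to_fiber f P) (fun i => inr (b i ^+ q)) ->
  forall y : BA, exists2 s, ~ spec_set P s & exists m, ispan P (s *: y - radu_linear m).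
Proof.
move=> ibq y; have [s ns [a sy]] := fiber_approx noethB (indep_spans spb ibq) y.
by exists s => //; exists (\sum_i a i *: (tr (b i) 1 : U)); rewrite radu_linear_sum.
Qed.

End AtPrime.

Hypothesis qf : almost_quasi_finite f.

(** Injectivity modulo P makes the b_i^q independent in the fibre; being as many as the b_i, they
    also span it, which is generic surjectivity. *)
Lemma radu_linear_bijective :
  (forall I, is_ideal I -> inj_mod radu_linear I) -> bijective radu_linear.
Proof.
move=> injI.
have surj : forall y, exists m, radu_linear m = y.
  apply: (surj_of_generic noethA injI) => P prP; last exact: torsion_bound.
  have [n [b [spb ib]]] := fiber_basis (qf (Spec prP)).
  have [idP _ _] := prP.
  by apply: (@generic_surj (Spec prP) n b) => //; apply: inj_mod_indep => //; apply: injI.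
have [g gK] := choice surj; exists g => // m.
apply/eqP; rewrite -subr_eq0; apply/eqP/ispan_eq0/injI; first exact: zero_is_ideal.
by rewrite linearB gK subrr; exact: ispan0.
Qed.

End RaduAndreFiber.

Lemma prime_preimage (A B : comPzRingType) (f : {rmorphism A -> B}) (Q : set B) :
  is_prime Q -> is_prime [set a | Q (f a)].
Proof.
move=> [[Q0 QD QM] Q1 prQ]; split=> [||x y]; rewrite /= ?rmorph1 //.
  split=> [|x y|a x] /=; rewrite ?rmorph0 ?rmorphD ?rmorphM //; [exact: QD|exact: QM].
by rewrite rmorphM; apply: prQ.
Qed.

Lemma frob_power_leq (p : nat) (R : comPzRingType) (P : set R) d e :
  is_ideal P -> (0 < p)%N -> (d <= e)%N -> frob_power (p ^ e) P `<=` frob_power (p ^ d) P.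
Proof.
move=> [_ _ PM] p0 /subnKC<-; apply: frob_power_sub; first exact: frob_power_is_ideal.
move=> y Py; rewrite expnD mulnC exprM; apply: frob_power_mem.
have : (0 < p ^ (e - d))%N by rewrite expn_gt0 p0.
by case: (p ^ _)%N => // n _; rewrite exprSr; apply: PM.
Qed.

Lemma ideal_add_mul_is_ideal (R : comPzRingType) (I K : set R) x : is_ideal I -> is_ideal K ->
  is_ideal [set z | exists2 i, I i & exists2 c, K c & z = i + c * x].
Proof.
move=> [I0 ID IM] [K0 KD KM].
split=> [|_ _ [i Ii [c Kc ->]] [j Ij [d Kd ->]]|a _ [i Ii [c Kc ->]]].
- by exists 0 => //; exists 0 => //; rewrite mul0r addr0.
- by exists (i + j); [exact: ID|exists (c + d); [exact: KD|ring]].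
- by exists (a * i); [exact: IM|exists (a * c); [exact: KM|ring]].
Qed.

(** * Flatness from bijectivity of the Radu-Andre homomorphisms *)

Section RelativelyPerfect.
Variables (p : nat) (pr_p : prime p) (A B : comPzRingType).
Variables (chA : p%:R = 0 :> A) (chB : p%:R = 0 :> B).
Variables (noethA : noetherian A) (noethB : noetherian B).
Variables (f : {rmorphism A -> B}) (qf : almost_quasi_finite f).
Local Notation BA := (alg_of f).

Section Approximation.
Variables (e : nat).
Hypothesis injI : forall I, is_ideal I -> inj_mod (radu_linear pr_p chA chB f e) I.
Variables (P : spec A) (n : nat) (b : 'I_n -> B).
Local Notation inr := (tens_inr (to_residue P) f).
Hypotheses (spb : spans (to_fiber f P) (fun i => inr (b i))).
Hypotheses (ib : indep (to_fiber f P) (fun i => inr (b i))).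
Local Notation Pq := (frob_power (p ^ e) P).
Local Notation c := (fun i => b i ^+ (p ^ e) : BA).

(** The inverse of Phi_e carries [source_approx] over to B, where the b_i (x) 1 become the b_i^q. *)
Lemma target_approx (y : BA) : exists2 d, ~ spec_set P d &
  exists a : 'I_n -> A, ispan Pq (d *: y - \sum_i a i *: c i).
Proof.
have [g _ gK] := radu_linear_bijective noethA noethB qf injI.
have [d nd [a da]] := source_approx noethB spb (g y).
exists d => //; exists a; rewrite -radu_linear_sum -[y]gK -linearZ -linearB.
exact: ispan_linear.
Qed.

Lemma target_approx_ideal I (y : BA) : is_ideal I -> ispan I y ->
  exists2 d, ~ spec_set P d & exists2 a : 'I_n -> A, (forall i, I (a i)) &
    ispan Pq (d *: y - \sum_i a i *: c i).
Proof.
move=> [I0 ID IM]; have [_ P1 prP] := specP P.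
elim=> [|x m z Ix _ [d nd [a Ia dz]]].
  exists 1 => //; exists (fun=> 0) => //; rewrite scaler0 big1 ?subr0; first exact: ispan0.
  by move=> i _; rewrite scale0r.
have [d' nd' [a' d'm]] := target_approx m.
exists (d' * d); first by move=> /prP[].
exists (fun i => (d * a' i) * x + d' * a i); first by move=> i; apply: ID; apply: IM.
have -> : (d' * d) *: (x *: m + z) - \sum_i (d * a' i * x + d' * a i) *: c i =
    (d * x) *: (d' *: m - \sum_i a' i *: c i) + d' *: (d *: z - \sum_i a i *: c i).
  under eq_bigr => i _.
    rewrite scalerDl (_ : d * a' i * x = (d * x) * a' i); last by ring.
    rewrite -!scalerA; over.
  rewrite big_split /= -!scaler_sumr !scalerBr scalerDr !scalerA opprD addrACA.
  by congr (_ - _ + (_ - _)); rewrite -?scaler_sumr ?scalerA //; congr (_ *: _); ring.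
by apply: ispanD; apply: ispan_scale.
Qed.

Lemma target_relation (a : 'I_n -> A) : ispan Pq (\sum_i a i *: c i) ->
  exists2 w, ~ spec_set P w & forall i, Pq (w * a i).
Proof.
rewrite -radu_linear_sum => /injI-/(_ (frob_power_is_ideal _ _)) ha.
by apply: (source_relation spb ib _ _ ha); [exact: frob_power_is_ideal|exact: frob_power_mem].
Qed.

End Approximation.

(** Suppose x y lies in IB but y does not lie in JB, with J = (I : x). Comparing coordinates modulo
    a large Frobenius power of P gives s outside P with s y in JB + P^[p^e1] B; at a prime Q
    containing (JB : y) and lying over P, Krull's argument then forces s into P. *)
Lemma relatively_perfect_colon :
  (forall e, (0 < e)%N -> forall I, is_ideal I -> inj_mod (radu_linear pr_p chA chB f e) I) ->
  has_colon BA.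
Proof.
move=> injI I x idI y Ixy; apply: contrapT => nJy.
have idJ := colon_is_ideal x idI.
pose JB : set B := [set z | ispan (colon I x) (z : BA)].
have idJB : is_ideal JB := ispan_extension f _.
have [||z Jz z1|Q prQ [JQ _]] := @prime_avoiding B [set 1] (colon JB y) noethB _ _
    (colon_is_ideal y idJB).
- by [].
- by move=> u v -> ->; rewrite /= mulr1.
- by apply: nJy; move: Jz; rewrite z1 /colon /= mul1r.
have [idQ Q1 prQ'] := prQ; have [Q0 QD QM] := idQ; have [J0 JD JM] := idJB.
pose P := Spec (prime_preimage f prQ).
have [idP P1 prP] := specP P.
(* The preimage in B of the localization of JB at Q, so that the local argument at Q can be made
   inside B. *)
pose L : set B := [set z | exists2 s, ~ Q s & JB (s * z)].
have idL : is_ideal L.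
  split=> [|u v [s ns su] [t nt tv]|a u [s ns su]].
  - by exists 1 => //; rewrite mulr0.
  - exists (s * t); first by move=> /prQ'[].
    rewrite mulrDr; apply: (JD); last by rewrite -mulrA; apply: (JM).
    by rewrite mulrC mulrA (mulrC u) mulrC; apply: (JM).
  - by exists s => //; rewrite mulrCA; apply: (JM).
pose E : set B := [set z | exists2 l, L l & exists2 c, Q c & z = l + c * y].
have [|||||e1 ar1] := @artin_rees p pr_p B chB E (ideal_add L y) Q noethB.
- exact: ideal_add_mul_is_ideal.
- exact: ideal_add_is_ideal.
- exact: idQ.
- by move=> z [l Ll [c _ ->]]; exists l => //; exists c.
- move=> u Qu; exists 1%N => _ [l Ll [c ->]]; rewrite expr1 mulrDr.
  exists (u * l); first by case: idL => _ _; apply.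
  by exists (u * c); [rewrite mulrC; apply: (QM)|rewrite mulrA].
(* The exponent e1 found in B comes first: Artin-Rees in A has to leave an error in P^[p^e1], small
   enough for the argument at Q. *)
pose E' : set A := [set z | exists2 i, I i & exists2 c, frob_power (p ^ e1) P c & z = i + c * x].
have idF := frob_power_is_ideal (p ^ e1) P.
have [|||||e2 ar2] := @artin_rees p pr_p A chA E' (ideal_add I x) P noethA.
- exact: ideal_add_mul_is_ideal.
- exact: ideal_add_is_ideal.
- exact: idP.
- by move=> z [l Il [c _ ->]]; exists l => //; exists c.
- move=> u Pu; exists (p ^ e1)%N => _ [l Il [c ->]]; rewrite mulrDr.
  exists (u ^+ (p ^ e1) * l); first by case: idI => _ _; apply.
  exists (u ^+ (p ^ e1) * c); last by rewrite mulrA.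
  by rewrite mulrC; case: idF => _ _; apply; exact: frob_power_mem.
(* The successor ensures 0 < e, the range in which Phi_e is known to be injective modulo ideals. *)
pose e := (maxn e1 e2).+1.
have e1e : (e1 <= e)%N by rewrite leqW // leq_maxl.
have e2e : (e2 <= e)%N by rewrite leqW // leq_maxr.
have {}injI := injI e isT.
have [n [b [spb ib]]] := fiber_basis (qf P).
have [d nd [a dy]] := target_approx injI spb y.
have [d' nd' [a' Ia' dxy]] := target_approx_ideal injI spb idI Ixy.
pose c i : BA := b i ^+ (p ^ e).
(* Both approximations expand d d' x y in the b_i^q; the coefficients can differ only by P^[p^e], up
   to a multiplier w. *)
have [w nw wP] : exists2 w, ~ spec_set P w &
    forall i, frob_power (p ^ e) P (w * (d' * x * a i - d * a' i)).
  apply: (target_relation injI spb ib).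
  have -> : \sum_i (d' * x * a i - d * a' i) *: c i =
      d *: (d' *: (x *: y) - \sum_i a' i *: c i) - (d' * x) *: (d *: y - \sum_i a i *: c i).
    rewrite !scalerBr !scalerA (_ : d * d' * x = d' * x * d); last by ring.
    rewrite opprB addrC subrKA !scaler_sumr -sumrB; apply: eq_bigr => i _.
    by rewrite scalerBl !scalerA.
  by apply: ispanB; apply: ispan_scale.
(* As a'_i lies in I, the difference of coefficients lies in I + (x), so Artin-Rees puts it into I +
   P^[p^e1] x. Dividing by x turns I into (I : x). *)
have uP i : exists2 j, colon I x j & exists2 t, frob_power (p ^ e1) P t &
    w * d' * a i = j + t.
  have [I0 ID IM] := idI.
  have xu : w * (d' * x * a i - d * a' i) = (w * d' * a i) * x - w * d * a' i by ring.
  have [|k Ik [t Pt tE]] := ar2 e e2e _ (wP i).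
    exists (- (w * d * a' i)); first by rewrite -mulNr; apply: IM.
    by exists (w * d' * a i); rewrite xu addrC.
  exists (w * d' * a i - t); last by exists t => //; rewrite subrK.
  rewrite /colon /= mulrBl.
  have -> : w * d' * a i * x - t * x = k + (w * d) * a' i.
    by rewrite -[k](addrK (t * x)) -tE xu; ring.
  by apply: ID => //; apply: IM.
pose s := w * d' * d.
have nPs : ~ Q (f s) by move=> /(prP (w * d') d)[/prP[]|].
have [h hP [j Jj syE]] : exists2 h : BA, ispan (frob_power (p ^ e1) P) h &
    exists2 j : BA, ispan (colon I x) j & s *: y = j + h.
  have /choice[j jP] : forall i, exists j, colon I x j /\
      exists2 t, frob_power (p ^ e1) P t & w * d' * a i = j + t.
    by move=> i; have [j] := uP i; exists j.
  exists (s *: y - \sum_i j i *: c i); last first.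
    exists (\sum_i j i *: c i); last by rewrite addrC subrK.
    by apply: ispan_sum => i; apply: ispanZ; case: (jP i).
  have -> : s *: y - \sum_i j i *: c i =
      (w * d') *: (d *: y - \sum_i a i *: c i) + \sum_i (w * d' * a i - j i) *: c i.
    rewrite scalerBr scalerA scaler_sumr -addrA; congr (_ + _).
    rewrite addrC -sumrB -sumrN; apply: eq_bigr => i _.
    by rewrite scalerBl scalerA addrAC subrr add0r.
  apply: ispanD.
    apply: ispan_scale; apply: ispan_sub dy; apply: frob_power_leq => //.
    exact: prime_gt0.
  apply: ispan_sum => i; apply: ispanZ; have [_ [t Pt ->]] := jP i.
  by rewrite addrC addKr.
have hQ : frob_power (p ^ e1) Q h.
  elim: hP => [|r m z Pr _ IH]; first by case: (frob_power_is_ideal (p ^ e1) Q).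
  have [_ FD FM] := frob_power_is_ideal (p ^ e1) Q.
  apply: (FD) => //; rewrite alg_ofZ mulrC; apply: (FM).
  have idr : is_ideal [set r | frob_power (p ^ e1) Q (f r)].
    split=> [|r1 r2|r1 r2] /=; rewrite ?rmorph0 ?rmorphD ?rmorphM //.
    - by case: (frob_power_is_ideal (p ^ e1) Q).
    - exact: FD.
    - exact: FM.
  apply: (frob_power_sub idr) Pr => v Qv /=.
  by rewrite rmorphXn; apply: frob_power_mem.
have hL : ideal_add L y h.
  exists (- j : B).
    by apply: (idealN idL); exists 1 => //; rewrite mul1r.
  exists (f s); have -> : (f s : B) * y = j + h := syE.
  by rewrite addrA addNr add0r.
(* Now h = l + k y with k in Q, so (s - k) y lies in L. Hence s - k, and with it s, would lie in
   Q. *)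
have [l [t nt Jtl] [k Qk hE]] := ar1 e1 (leqnn _) _ hQ hL.
have ty : JB (t * (f s - k) * y).
  have -> : t * (f s - k) * y = t * (j : B) + t * l.
    have syE' : (f s : B) * y = j + h := syE.
    by rewrite -mulrA mulrBl syE' hE; ring.
  by apply: (JD) => //; apply: (JM).
have /prQ'[//|Qsk] := JQ _ ty.
by apply: nPs; rewrite -(subrK k (f s)); apply: QD.
Qed.

End RelativelyPerfect.

Theorem theorem2p19 (p : nat) (pr_p : prime p) (A B : comPzRingType)
    (chA : p%:R = 0 :> A) (chB : p%:R = 0 :> B)
    (noethA : noetherian A) (noethB : noetherian B)
    (f : {rmorphism A -> B}) (qf : almost_quasi_finite f) :
  [<-> regular_rmorphism f;
       F_pure pr_p chA chB f;
       dumitrescu pr_p chA chB f].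
Proof.
split=> [[flatf georeg] e _|].
  have bij : bijective (radu_linear pr_p chA chB f e).
    (* S_e is flat over A as a base change of B; the fibres supply the generic injectivity. *)
    apply: radu_linear_bijective => //; apply: inj_mod_of_generic => //.
    - by apply/flat_has_colon/base_change_flat.
    - exact: flat_has_colon.
    - move=> P prP m hm; have [n [b [spb ib]]] := fiber_basis (qf (Spec prP)).
      apply: (@generic_inj _ _ _ _ _ _ noethB _ _ (Spec prP) _ _ spb _ _ hm).
      have chk : p%:R = 0 :> residue_field (Spec prP).
        by rewrite -(rmorph_nat (to_residue (Spec prP))) chA rmorph0.
      move=> z zb; apply: (geom_regular_indep pr_p chk spb ib (e := e) (georeg _)).
      by rewrite -[RHS]zb; apply: eq_bigr => i _; rewrite rmorphXn.
  exact: bijective_pure.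
(* Purity over S_e implies purity over A, by extending A-modules to S_e. *)
split=> [Fp e e0|dum]; first exact/pure_rmorphism_linear/Fp.
have injI e : (0 < e)%N -> forall I, is_ideal I -> inj_mod (radu_linear pr_p chA chB f e) I.
  by move=> e0 I idI; apply: pure_inj_mod => //; exact: dum.
split; first exact/colon_flat/(relatively_perfect_colon noethA noethB qf injI).
move=> P; have [n [b [spb ib]]] := fiber_basis (qf P).
have chk : p%:R = 0 :> residue_field P.
  by rewrite -(rmorph_nat (to_residue P)) chA rmorph0.
apply: (indep_geom_regular pr_p chk spb).
have idP : is_ideal P by case: (specP P).
(* For the fibres e = 1 is enough, since independence of the p-th powers already gives geometric
   regularity. *)
have := inj_mod_indep noethB spb ib (injI 1%N isT P idP).
rewrite expn1 => ibp z zb; apply: ibp; rewrite -[RHS]zb.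
by apply: eq_bigr => i _; rewrite rmorphXn.
Qed.
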